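(* Let $G$ be a profinite group and $k$ a field of characteristic $p$ (a prime or zero). The following statements hold: (a) For every open normal subgroup $H$ of $G$ with $p\nmid |H|$, a $G/H$-module over $k$ is projective (as a $k[G/H]$-module) if and only if it is projective over $G$ (i.e. as an object of ${}_G^d\mathrm{Vect}$, with $G$ acting through $G\to G/H$). (b) The projective objects in ${}_G^d\mathrm{Vect}$ are precisely the objects isomorphic to direct sums of finite-dimensional, indecomposable projective $G/H$-modules over $k$ (regarded as discrete $G$-modules through $G\to G/H$), where $H$ ranges over the open normal subgroups of $G$ with $p\nmid|H|$ (different summands may use different $H$). If $p=0$, the condition $p\nmid |H|$ is regarded as satisfied by every open normal subgroup $H$.
   Context: ${}_G^d\mathrm{Vect}$ is the category of discrete $G$-modules over $k$: $k$-vector spaces $M$ with a $k$-linear left action of $G$ such that $G\times M\to M$ is continuous when $M$ has the discrete topology (equivalently, every element of $M$ is fixed by some open normal subgroup of $G$), with $k$-linear $G$-equivariant maps as morphisms. A supernatural number is a formal product $\prod_{\ell\text{ prime}}\ell^{n_\ell}$ with $n_\ell\in\mathbb{Z}_{\ge 0}\cup\{\infty\}$. The order $|H|$ of a profinite group $H$ is the supernatural number defined as the least common multiple of the orders $|H/U|$, where $U$ ranges over the open normal subgroups of $H$. For a prime $p$, $p\nmid|H|$ means that the exponent of $p$ in $|H|$ is $0$. *)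

(* Defs.v *)
From HB Require Import structures.
From mathcomp Require Import all_boot all_order all_algebra finmap generic_quotient.
From mathcomp Require Import all_classical topology.
From mathcomp Require Import monalg.

Set Implicit Arguments.
Unset Strict Implicit.
Unset Printing Implicit Defensive.

Import GRing.Theory.

Local Open Scope classical_set_scope.
Local Open Scope ring_scope.

HB.structure Definition PreTopologicalGroup := {G of Group G & Topological G}.

HB.mixin Record PreTopologicalGroup_isTopologicalGroup G
    of PreTopologicalGroup G := {
  mulg_continuous : continuous (fun xy : G * G => (xy.1 * xy.2)%g);
  invg_continuous : continuous (fun x : G => (x^-1)%g)
}.

#[short(type="topologicalGroupType")]
HB.structure Definition TopologicalGroup :=
  {G of PreTopologicalGroup G & PreTopologicalGroup_isTopologicalGroup G}.

Definition profinite (G : topologicalGroupType) : Prop :=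
  [/\ compact [set: G], hausdorff_space G & totally_disconnected [set: G]].

Record openNormal (G : topologicalGroupType) := OpenNormal {
  openNormal_set :> set G;
  openNormal1 : openNormal_set 1%g;
  openNormalM : forall x y, openNormal_set x -> openNormal_set y ->
    openNormal_set (x * y)%g;
  openNormalV : forall x, openNormal_set x -> openNormal_set (x^-1)%g;
  openNormalJ : forall x y, openNormal_set x -> openNormal_set (x ^ y)%g;
  openNormal_open : open openNormal_set
}.

(** The subgroup itself as a topological group, with the subspace topology
    already carried by [set_type]. *)
Definition subgroup (G : topologicalGroupType) (H : openNormal G) : Type :=
  set_type H.

Section Subgroup.
Variables (G : topologicalGroupType) (H : openNormal G).

HB.instance Definition _ := Topological.copy (subgroup H) (set_type H).

Implicit Types x y z : subgroup H.

Definition subgroup_val x : G := set_val x.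

Lemma subgroup_valP x : openNormal_set H (subgroup_val x).
Proof. by case: x => g gH; exact: set_mem gH. Qed.

Definition subgroup_sub (g : G) (Hg : openNormal_set H g) : subgroup H :=
  exist _ g (mem_set Hg).

Lemma subgroup_val_inj : injective subgroup_val.
Proof. by move=> x y /val_inj. Qed.

Definition subgroup_one : subgroup H := subgroup_sub (openNormal1 H).
Definition subgroup_mul x y : subgroup H :=
  subgroup_sub (openNormalM (subgroup_valP x) (subgroup_valP y)).
Definition subgroup_inv x : subgroup H :=
  subgroup_sub (openNormalV (subgroup_valP x)).

Lemma subgroup_mulA : associative subgroup_mul.
Proof. by move=> x y z; apply/subgroup_val_inj/mulgA. Qed.
Lemma subgroup_mul1 : left_id subgroup_one subgroup_mul.
Proof. by move=> x; apply/subgroup_val_inj/mul1g. Qed.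
Lemma subgroup_mulr1 : right_id subgroup_one subgroup_mul.
Proof. by move=> x; apply/subgroup_val_inj/mulg1. Qed.
Lemma subgroup_mulV : left_inverse subgroup_one subgroup_inv subgroup_mul.
Proof. by move=> x; apply/subgroup_val_inj/mulVg. Qed.
Lemma subgroup_mulrV : right_inverse subgroup_one subgroup_inv subgroup_mul.
Proof. by move=> x; apply/subgroup_val_inj/mulgV. Qed.

HB.instance Definition _ := isGroup.Build (subgroup H)
  subgroup_mulA subgroup_mul1 subgroup_mulr1 subgroup_mulV subgroup_mulrV.

Lemma subgroup_val_continuous : continuous subgroup_val.
Proof. exact: initial_continuous. Qed.

Lemma subgroup_continuous (T : topologicalType) (f : T -> subgroup H) :
  continuous (subgroup_val \o f) -> continuous f.
Proof. by move=> cf; apply: continuous_comp_initial. Qed.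

Lemma subgroup_mul_continuous :
  continuous (fun xy : subgroup H * subgroup H => (xy.1 * xy.2)%g).
Proof.
apply: subgroup_continuous => xy.
apply: (@continuous_comp _ _ _
  (fun xy : subgroup H * subgroup H => (subgroup_val xy.1, subgroup_val xy.2))
  (fun xy : G * G => (xy.1 * xy.2)%g)); last exact: mulg_continuous.
apply: cvg_pair; apply: continuous_comp;
  [exact: cvg_fst|exact: subgroup_val_continuous
  |exact: cvg_snd|exact: subgroup_val_continuous].
Qed.

Lemma subgroup_inv_continuous : continuous (fun x : subgroup H => (x^-1)%g).
Proof.
apply: subgroup_continuous => x.
apply: (@continuous_comp _ _ _ subgroup_val (fun x : G => (x^-1)%g));
  [exact: subgroup_val_continuous|exact: invg_continuous].
Qed.

HB.instance Definition _ := PreTopologicalGroup_isTopologicalGroup.Build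
  (subgroup H) subgroup_mul_continuous subgroup_inv_continuous.

End Subgroup.

(** Elements of the quotient are left cosets; its topology is not needed. *)
Section Quotient.
Variables (G : topologicalGroupType) (H : openNormal G).

Definition coset_rel (x y : G) : bool := `[< openNormal_set H (x^-1 * y)%g >].

Lemma coset_rel_equiv : equiv_class_of coset_rel.
Proof.
split=> [x|x y|y x z].
- by apply/asboolP; rewrite mulVg; exact: openNormal1.
- by apply/asboolP/asboolP => /openNormalV; rewrite invgM invgK.
- move=> /asboolP Hxy /asboolP Hyz; apply/asboolP.
  by have := openNormalM Hxy Hyz; rewrite -mulgA mulVKg.
Qed.

Canonical coset_equiv := EquivRelPack coset_rel_equiv.

Definition quotient_group : Type := {eq_quot coset_rel}%qT.

HB.instance Definition _ := Choice.on quotient_group.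

Definition coset (x : G) : quotient_group := \pi_({eq_quot coset_rel})%qT x.

Lemma coset_eqP x y : coset x = coset y <-> openNormal_set H (x^-1 * y)%g.
Proof.
split=> [|Hxy]; first by move/eqmodP => /asboolP.
by apply/eqmodP/asboolP.
Qed.

Lemma coset_surj (q : quotient_group) : exists x, coset x = q.
Proof. by exists (repr (q : {eq_quot coset_rel}%qT)); exact: reprK. Qed.

Let rep (q : quotient_group) : G := repr (q : {eq_quot coset_rel}%qT).

Let cosetK q : coset (rep q) = q.
Proof. exact: reprK. Qed.

Definition quotient_mul (p q : quotient_group) : quotient_group :=
  coset (rep p * rep q)%g.
Definition quotient_inv (p : quotient_group) : quotient_group :=
  coset ((rep p)^-1)%g.

Let repP x : exists2 h, openNormal_set H h & rep (coset x) = (x * h)%g.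
Proof.
exists (x^-1 * rep (coset x))%g; last by rewrite mulVKg.
by apply/coset_eqP; rewrite cosetK.
Qed.

Let coset_mulE x y : quotient_mul (coset x) (coset y) = coset (x * y)%g.
Proof.
rewrite /quotient_mul; have [h Hh ->] := repP x; have [l Hl ->] := repP y.
apply/esym/coset_eqP; rewrite invgM.
have -> : (y^-1 * x^-1 * (x * h * (y * l)) = h ^ y * l)%g.
  by rewrite /conjg !mulgA mulgVK.
exact: openNormalM (openNormalJ _ Hh) Hl.
Qed.

Let coset_invE x : quotient_inv (coset x) = coset (x^-1)%g.
Proof.
rewrite /quotient_inv; have [h Hh ->] := repP x.
apply/coset_eqP; rewrite invgK.
have -> : (x * h * x^-1 = h ^ (x^-1))%g by rewrite /conjg invgK mulgA.
exact: openNormalJ.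
Qed.

Let quotient_mulA : associative quotient_mul.
Proof.
move=> p q r; rewrite -(cosetK p) -(cosetK q) -(cosetK r).
by rewrite !coset_mulE mulgA.
Qed.
Let quotient_mul1 : left_id (coset 1%g) quotient_mul.
Proof. by move=> p; rewrite -(cosetK p) coset_mulE mul1g. Qed.
Let quotient_mulr1 : right_id (coset 1%g) quotient_mul.
Proof. by move=> p; rewrite -(cosetK p) coset_mulE mulg1. Qed.
Let quotient_mulV : left_inverse (coset 1%g) quotient_inv quotient_mul.
Proof. by move=> p; rewrite -(cosetK p) coset_invE coset_mulE mulVg. Qed.
Let quotient_mulrV : right_inverse (coset 1%g) quotient_inv quotient_mul.
Proof. by move=> p; rewrite -(cosetK p) coset_invE coset_mulE mulgV. Qed.

HB.instance Definition _ := isGroup.Build quotient_group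
  quotient_mulA quotient_mul1 quotient_mulr1 quotient_mulV quotient_mulrV.

Lemma cosetM x y : coset (x * y)%g = (coset x * coset y)%g.
Proof. by rewrite -coset_mulE. Qed.

Lemma coset1 : coset 1%g = 1%g.
Proof. by []. Qed.

End Quotient.

(** [n l] is the exponent of the prime [l], [None] standing for infinity; the
    values at non-primes are irrelevant. *)
Definition supernatural := nat -> option nat.

Definition supernatural_lcm (A : set nat) : supernatural := fun l =>
  match pselect (exists e, `[< forall a, A a -> (logn l a <= e)%N >]) with
  | left bounded => Some (ex_minn bounded)
  | right _ => None
  end.

Definition profinite_order (G : topologicalGroupType) : supernatural :=
  supernatural_lcm
    [set n | exists U : openNormal G, ([set: quotient_group U] #= `I_n)%card].

(** [p = 0] encodes characteristic zero. *)
Definition has_characteristic (k : fieldType) (p : nat) : Prop :=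
  if p == 0%N then [pchar k] =i pred0 else p \in [pchar k].

Definition order_prime_to (p : nat) (G : topologicalGroupType) : Prop :=
  p = 0%N \/ profinite_order G p = Some 0%N.

Definition projective_module (R : nzRingType) (P : lmodType R) : Prop :=
  forall (A B : lmodType R) (e : {linear A -> B}) (f : {linear P -> B}),
    (forall b, exists a, e a = b) ->
    exists g : {linear P -> A}, forall x, e (g x) = f x.

Definition indecomposable_module (R : nzRingType) (V : lmodType R) : Prop :=
  (exists v : V, v != 0) /\
  forall A B : {pred V}, submod_closed A -> submod_closed B ->
    (forall v, exists a b, [/\ a \in A, b \in B & v = a + b]) ->
    (forall v, v \in A -> v \in B -> v = 0) ->
    (forall v, v \in A -> v = 0) \/ (forall v, v \in B -> v = 0).

Definition finite_dimensional (k : fieldType) (V : lmodType k) : Prop :=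
  exists (n : nat) (v : 'I_n -> V),
    forall w, exists c : 'I_n -> k, w = \sum_(i < n) c i *: v i.

Definition group_algebra (k : fieldType) (Q : groupType) : Type := {malg k[Q]}.

Section GroupAlgebra.
Variables (k : fieldType) (Q : groupType).

HB.instance Definition _ := GRing.Lmodule.copy (group_algebra k Q) {malg k[Q]}.

Local Notation kQ := (group_algebra k Q).
Implicit Types a b c : kQ.

Definition gaU (x : k) (q : Q) : kQ := << x *g q >>.

Definition gamul a b : kQ :=
  \sum_(q <- msupp a) \sum_(r <- msupp b) gaU (a@_q * b@_r) (q * r)%g.

Definition gaone : kQ := gaU 1 1%g.

Let gaU0 q : gaU 0 q = 0. Proof. exact: monalgU0. Qed.

Let gaUD x y q : gaU (x + y) q = gaU x q + gaU y q.
Proof. exact: monalgUD. Qed.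

Lemma gaE a : a = \sum_(q <- msupp a) gaU (a@_q) q.
Proof. exact: monalgE. Qed.

Lemma gamulw (d1 d2 : {fset Q}) a b :
  (msupp a `<=` d1)%fset -> (msupp b `<=` d2)%fset ->
  gamul a b = \sum_(q <- d1) \sum_(r <- d2) gaU (a@_q * b@_r) (q * r)%g.
Proof.
move=> le_d1 le_d2; rewrite /gamul (big_fset_incl _ le_d1) /=.
  apply/eq_bigr=> q _; apply/big_fset_incl => // r _ /mcoeff_outdom ->.
  by rewrite mulr0 gaU0.
move=> q _ /mcoeff_outdom aq.
by rewrite big1 => // r _; rewrite aq mul0r gaU0.
Qed.

Lemma gamul0g : left_zero 0 gamul.
Proof. by move=> a; rewrite /gamul msupp0 big_seq_fset0. Qed.

Lemma gamulg0 : right_zero 0 gamul.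
Proof.
by move=> a; rewrite /gamul exchange_big /= msupp0 big_seq_fset0.
Qed.

Lemma gamulUg x q a :
  gamul (gaU x q) a = \sum_(r <- msupp a) gaU (x * a@_r) (q * r)%g.
Proof.
rewrite (gamulw (@msuppU_le _ _ q x) (fsubset_refl _)) big_seq_fset1.
by apply/eq_bigr => r _; rewrite mcoeffUU.
Qed.

Lemma gamulgU x q a :
  gamul a (gaU x q) = \sum_(r <- msupp a) gaU (a@_r * x) (r * q)%g.
Proof.
rewrite (gamulw (fsubset_refl _) (@msuppU_le _ _ q x)).
by apply/eq_bigr=> r _; rewrite big_seq_fset1 mcoeffUU.
Qed.

Lemma gamulUU x y q r : gamul (gaU x q) (gaU y r) = gaU (x * y) (q * r)%g.
Proof.
rewrite (gamulw (@msuppU_le _ _ q x) (@msuppU_le _ _ r y)).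
by rewrite !big_seq_fset1 !mcoeffUU.
Qed.

Lemma gamul1g : left_id gaone gamul.
Proof.
move=> a; rewrite gamulUg [RHS]gaE.
by apply/eq_bigr=> q _; rewrite mul1r mul1g.
Qed.

Lemma gamulg1 : right_id gaone gamul.
Proof.
move=> a; rewrite gamulgU [RHS]gaE.
by apply/eq_bigr=> q _; rewrite mulr1 mulg1.
Qed.

Lemma gamulDl : left_distributive gamul +%R.
Proof.
move=> a b c.
rewrite [in RHS](gamulw (fsubsetUl _ (msupp b)) (fsubset_refl _)).
rewrite [in RHS](gamulw (fsubsetUr (msupp a) _) (fsubset_refl _)).
rewrite (gamulw (msuppD_le _ _) (fsubset_refl _)).
rewrite -big_split /=; apply/eq_bigr=> q _.
rewrite -big_split /=; apply/eq_bigr=> r _.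
by rewrite mcoeffD mulrDl gaUD.
Qed.

Lemma gamulDr : right_distributive gamul +%R.
Proof.
move=> c a b.
rewrite [in RHS](gamulw (fsubset_refl _) (fsubsetUl _ (msupp b))).
rewrite [in RHS](gamulw (fsubset_refl _) (fsubsetUr (msupp a) _)).
rewrite (gamulw (fsubset_refl _) (msuppD_le _ _)).
rewrite -big_split /=; apply/eq_bigr=> q _.
rewrite -big_split /=; apply/eq_bigr=> r _.
by rewrite mcoeffD mulrDr gaUD.
Qed.

Lemma gamul_suml (I : Type) (s : seq I) (F : I -> kQ) a :
  gamul (\sum_(i <- s) F i) a = \sum_(i <- s) gamul (F i) a.
Proof.
exact: (big_morph (gamul^~ _) (fun _ _ => gamulDl _ _ _) (gamul0g _)).
Qed.

Lemma gamul_sumr (I : Type) (s : seq I) (F : I -> kQ) a :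
  gamul a (\sum_(i <- s) F i) = \sum_(i <- s) gamul a (F i).
Proof.
exact: (big_morph (gamul _) (fun _ _ => gamulDr _ _ _) (gamulg0 _)).
Qed.

Lemma gamulA : associative gamul.
Proof.
move=> a b c; rewrite (gaE a) !gamul_suml; apply/eq_bigr=> q _.
rewrite (gaE b) gamul_suml !gamul_sumr gamul_suml; apply/eq_bigr=> r _.
rewrite (gaE c) !gamul_sumr; apply/eq_bigr=> s _.
by rewrite !gamulUU mulrA mulgA.
Qed.

Lemma gaone_neq0 : gaone != 0.
Proof. by rewrite /gaone /gaU monalgU_eq0 oner_eq0. Qed.

HB.instance Definition _ := GRing.Zmodule_isNzRing.Build kQ
  gamulA gamul1g gamulg1 gamulDl gamulDr gaone_neq0.

Lemma gaUM x y q r : gaU x q * gaU y r = gaU (x * y) (q * r)%g.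
Proof. exact: gamulUU. Qed.

Lemma ga1 : gaU 1 1%g = 1 :> kQ.
Proof. by []. Qed.

End GroupAlgebra.

(** Restriction of scalars along k -> k[Q]. *)
Definition underlying (k : fieldType) (Q : groupType)
  (V : lmodType (group_algebra k Q)) : Type := V.

Section Underlying.
Variables (k : fieldType) (Q : groupType) (V : lmodType (group_algebra k Q)).

HB.instance Definition _ := GRing.Zmodule.copy (underlying V) V.

Let scale (x : k) (v : underlying V) : underlying V := gaU x 1%g *: (v : V).

Let scaleA x y v : scale x (scale y v) = scale (x * y) v.
Proof. by rewrite /scale scalerA gaUM mulg1. Qed.
Let scale1 : left_id 1 scale.
Proof. by move=> v; rewrite /scale ga1 scale1r. Qed.
Let scaleDr : right_distributive scale +%R.
Proof. by move=> x u v; rewrite /scale scalerDr. Qed.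
Let scaleDl v : {morph scale^~ v : x y / x + y}.
Proof. by move=> x y; rewrite /scale /gaU monalgUD scalerDl. Qed.

HB.instance Definition _ := GRing.Zmodule_isLmodule.Build k (underlying V)
  scaleA scale1 scaleDr scaleDl.

Lemma underlying_scaleE x (v : underlying V) :
  x *: v = gaU x 1%g *: (v : V) :> V.
Proof. by []. Qed.

End Underlying.

Record discreteModule (k : fieldType) (G : topologicalGroupType) :=
  DiscreteModule {
    dm_sort :> lmodType k;
    dm_act : G -> dm_sort -> dm_sort;
    dm_act_linear : forall g, linear (dm_act g);
    dm_act1 : forall m, dm_act 1%g m = m;
    dm_actM : forall g h m, dm_act (g * h)%g m = dm_act g (dm_act h m);
    dm_act_continuous : continuous
      (fun gm : G * discrete_topology dm_sort =>
         dm_act gm.1 gm.2 : discrete_topology dm_sort)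
  }.

Section Category.
Variables (k : fieldType) (G : topologicalGroupType).
Implicit Types A B C M N P : discreteModule k G.

Record dm_hom M N := DmHom {
  dm_fun :> {linear M -> N};
  dm_funJ : forall g m, dm_fun (dm_act g m) = dm_act g (dm_fun m)
}.

(** Epimorphisms in the categorical sense, not surjections. *)
Definition dm_epi A B (e : dm_hom A B) : Prop :=
  forall C (f g : dm_hom B C), (forall a, f (e a) = g (e a)) ->
    forall b, f b = g b.

Definition projective_object P : Prop :=
  forall A B (e : dm_hom A B) (f : dm_hom P B), dm_epi e ->
    exists g : dm_hom P A, forall x, e (g x) = f x.

Definition dm_isomorphic M N : Prop :=
  exists (f : dm_hom M N) (g : dm_hom N M), cancel f g /\ cancel g f.

End Category.

Section Continuity.
Variables (k : fieldType) (G : topologicalGroupType) (M : lmodType k).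
Variable act : G -> M -> M.
Hypothesis actM : forall g h m, act (g * h)%g m = act g (act h m).

Lemma act_continuousP :
  (forall m, \forall g \near (1%g : G), act g m = m) ->
  continuous (fun gm : G * discrete_topology M =>
    act gm.1 gm.2 : discrete_topology M).
Proof.
move=> stab [g m] /= U /principal_filterP Ugm.
have near_g : \forall h \near g, act h m = act g m.
  have cg : (fun h : G => (g^-1 * h)%g) @ g --> (1%g : G).
    rewrite -[X in _ --> X](mulVg g).
    apply: (@continuous_comp _ _ _ (fun h : G => ((g^-1)%g, h))
      (fun xy : G * G => (xy.1 * xy.2)%g) g); last exact: mulg_continuous.
    by apply: cvg_pair; [exact: (@cvg_cst G)|exact: cvg_id].
  have near_m : \forall h \near g, act (g^-1 * h)%g m = m := cg _ (stab m).
  apply: filterS near_m => h hm.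
  by rewrite -[in RHS]hm -actM mulVKg.
exists ([set h | act h m = act g m], [set m]) => /=.
  by split=> //; exact: (@discrete_set1 (discrete_topology M)).
by move=> [h n] /= [hg ->]; rewrite hg.
Qed.

End Continuity.

Lemma dm_stab (k : fieldType) (G : topologicalGroupType)
  (M : discreteModule k G) (m : M) :
  \forall g \near (1%g : G), dm_act g m = m.
Proof.
have := @dm_act_continuous _ _ M (1%g, m) [set m].
rewrite /= dm_act1 => /(_ (@discrete_set1 (discrete_topology M) m)).
case=> -[A B] /= [A1 Bm] AB; apply: filterS A1 => g Ag.
by apply: (AB (g, m)); split=> //=; exact: nbhs_singleton Bm.
Qed.

Section Inflation.
Variables (k : fieldType) (G : topologicalGroupType) (H : openNormal G).
Variable V : lmodType (group_algebra k (quotient_group H)).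

Let act (g : G) (v : underlying V) : underlying V :=
  gaU 1 (coset H g) *: (v : V).

Let act_linear g : linear (act g).
Proof.
move=> x u v; rewrite /act scalerDr; congr (_ + _).
by rewrite !underlying_scaleE !scalerA !gaUM mul1r mulr1 mul1g mulg1.
Qed.

Let act1 v : act 1%g v = v.
Proof. by rewrite /act coset1 ga1 scale1r. Qed.

Let actM g h v : act (g * h)%g v = act g (act h v).
Proof. by rewrite /act scalerA gaUM mulr1 cosetM. Qed.

Let act_continuous : continuous
  (fun gm : G * discrete_topology (underlying V) =>
     act gm.1 gm.2 : discrete_topology (underlying V)).
Proof.
apply: act_continuousP => // v.
have : nbhs (1%g : G) H.
  by apply: open_nbhs_nbhs; split; [exact: openNormal_open|exact: openNormal1].
apply: filterS => g Hg; rewrite -[RHS]act1 /act.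
suff -> : coset H g = coset H 1%g by [].
by apply/esym/coset_eqP; rewrite invg1 mul1g.
Qed.

Definition inflation : discreteModule k G :=
  DiscreteModule act_linear act1 actM act_continuous.

Lemma inflation_actE g (v : inflation) :
  dm_act g v = gaU 1 (coset H g) *: (v : V) :> V.
Proof. by []. Qed.

End Inflation.

Section DirectSum.
Variables (k : fieldType) (G : topologicalGroupType).
Variables (I : choiceType) (M : I -> discreteModule k G).

Definition direct_sum_type : Type :=
  {f : forall i, M i | `[< finite_set [set i | f i != 0] >]}.

HB.instance Definition _ := Choice.on direct_sum_type.

Definition ds_val (f : direct_sum_type) : forall i, M i := val f.

Lemma ds_eqP (f g : direct_sum_type) : (forall i, ds_val f i = ds_val g i) ->
  f = g.
Proof. by move=> fg; apply/val_inj/functional_extensionality_dep. Qed.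

Lemma ds_finite f : finite_set [set i | ds_val f i != 0].
Proof. by case: f => f fin; exact/asboolP. Qed.

Definition ds_mk (f : forall i, M i) (fin : finite_set [set i | f i != 0]) :
  direct_sum_type := exist _ f (introT (asboolP _) fin).

Let fin0 : finite_set [set i | (0 : M i) != 0].
Proof.
by apply: sub_finite_set (finite_set0 I) => i /=; rewrite eqxx.
Qed.
Let finN f : finite_set [set i | - ds_val f i != 0].
Proof.
by apply: sub_finite_set (ds_finite f) => i /=; rewrite oppr_eq0.
Qed.
Let finD f g : finite_set [set i | ds_val f i + ds_val g i != 0].
Proof.
have fin : finite_set
    ([set i | ds_val f i != 0] `|` [set i | ds_val g i != 0]).
  by rewrite finite_setU; split; exact: ds_finite.
apply: sub_finite_set fin => i /=; have [->|] := eqVneq (ds_val f i) 0.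
  by rewrite add0r; right.
by left.
Qed.
Let finZ (x : k) f : finite_set [set i | x *: ds_val f i != 0].
Proof.
apply: sub_finite_set (ds_finite f) => i /=.
by apply: contraNneq => ->; rewrite scaler0.
Qed.

Let zero := ds_mk fin0.
Let opp f := ds_mk (finN f).
Let add f g := ds_mk (finD f g).
Let scale x f := ds_mk (finZ x f).

Let addA : associative add.
Proof. by move=> f g h; apply: ds_eqP => i; exact: addrA. Qed.
Let addC : commutative add.
Proof. by move=> f g; apply: ds_eqP => i; exact: addrC. Qed.
Let add0 : left_id zero add.
Proof. by move=> f; apply: ds_eqP => i; exact: add0r. Qed.
Let addN : left_inverse zero opp add.
Proof. by move=> f; apply: ds_eqP => i; exact: addNr. Qed.

HB.instance Definition _ := GRing.isZmodule.Build direct_sum_type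
  addA addC add0 addN.

Let scaleA x y f : scale x (scale y f) = scale (x * y) f.
Proof. by apply: ds_eqP => i; exact: scalerA. Qed.
Let scale1 : left_id 1 scale.
Proof. by move=> f; apply: ds_eqP => i; exact: scale1r. Qed.
Let scaleDr : right_distributive scale +%R.
Proof. by move=> x f g; apply: ds_eqP => i; exact: scalerDr. Qed.
Let scaleDl f : {morph scale^~ f : x y / x + y}.
Proof. by move=> x y; apply: ds_eqP => i; exact: scalerDl. Qed.

HB.instance Definition _ := GRing.Zmodule_isLmodule.Build k direct_sum_type
  scaleA scale1 scaleDr scaleDl.

Let dm_act0 (N : discreteModule k G) g : dm_act g (0 : N) = 0.
Proof.
by have := @dm_act_linear _ _ N g (-1) 0 0; rewrite scaler0 addr0 scaleN1r addNr.
Qed.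

Let finJ g f : finite_set [set i | dm_act g (ds_val f i) != 0].
Proof.
apply: sub_finite_set (ds_finite f) => i /=.
by apply: contraNneq => ->; rewrite dm_act0.
Qed.

Let act g f : direct_sum_type := ds_mk (finJ g f).

Let act_linear g : linear (act g).
Proof. by move=> x f h; apply: ds_eqP => i; exact: dm_act_linear. Qed.
Let act1 f : act 1%g f = f.
Proof. by apply: ds_eqP => i; exact: dm_act1. Qed.
Let actM g h f : act (g * h)%g f = act g (act h f).
Proof. by apply: ds_eqP => i; exact: dm_actM. Qed.

Let act_continuous : continuous
  (fun gm : G * discrete_topology direct_sum_type =>
     act gm.1 gm.2 : discrete_topology direct_sum_type).
Proof.
apply: act_continuousP => // f.
have /finite_fsetP[s sE] := ds_finite f.
have near_s : \forall g \near (1%g : G),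
    (\bigcap_(i in [set` s]) [set h | dm_act h (ds_val f i) = ds_val f i]) g.
  by apply: filter_bigI => i _; exact: dm_stab.
apply: filterS near_s => g fix_s; apply: ds_eqP => i /=.
have [fi0|fi0] := eqVneq (ds_val f i) 0.
  by rewrite /ds_val /= -/(ds_val f i) fi0; exact: dm_act0.
by apply: fix_s; rewrite -sE.
Qed.

Definition direct_sum : discreteModule k G :=
  DiscreteModule act_linear act1 actM act_continuous.

Lemma ds_val_act g (f : direct_sum) i :
  ds_val (dm_act g f) i = dm_act g (ds_val f i).
Proof. by []. Qed.
Lemma ds_val0 i : ds_val (0 : direct_sum) i = 0.
Proof. by []. Qed.
Lemma ds_valD (f g : direct_sum) i : ds_val (f + g) i = ds_val f i + ds_val g i.
Proof. by []. Qed.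
Lemma ds_valZ x (f : direct_sum) i : ds_val (x *: f) i = x *: ds_val f i.
Proof. by []. Qed.

End DirectSum.

(* Main.v *)
Require Import Defs.
From HB Require Import structures.
From mathcomp Require Import all_boot all_order all_algebra finmap generic_quotient.
From mathcomp Require Import all_classical topology.
From mathcomp Require Import monalg ring.

Set Implicit Arguments.
Unset Strict Implicit.
Unset Printing Implicit Defensive.

Import GRing.Theory.

Local Open Scope classical_set_scope.
Local Open Scope ring_scope.

(** Everything rests on averaging. Suppose that K is an open normal subgroup
    such that all the indices [K : W], for W open normal in G and contained in
    K, are invertible in k; this is what p not dividing |K| means. Then k
    carries a translation-invariant measure on G giving K the mass 1, locally
    constant functions from G to a k-vector space can be integrated, and every
    k-linear map theta : M -> N between discrete modules yields a
    G-homomorphism, its trace m |-> integral of g theta(g^-1 m). Taking the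
    trace commutes with composition with homomorphisms on either side.

    This gives Higman's criterion: a discrete module M is projective if and
    only if its identity is the trace of some k-linear theta. If it is, a
    homomorphism f from M lifts along a surjection e as the trace of
    s f theta, for any k-linear section s of e
    ([identity_is_trace_projective]); dually, embeddings of M split
    ([identity_is_trace_injective]). Conversely M is a quotient, hence a
    retract when it is projective, of the module of functions G/K -> M, whose
    identity is the trace of the restriction to the coset K
    ([projective_identity_is_trace]). Since K acts trivially on that function
    module when it does so on M, the same argument over k[G/K] proves (a).

    For (b), a suitable K exists as soon as there is a nonzero projective P
    ([projective_prime_to]). Indeed P embeds into the direct sum of invariant
    submodules P^U that covers it, so some homomorphism rho from P to a module
    fixed by an open normal U does not vanish at some x, and U may be shrunk to
    fix x. If p divided an index [U : W], then lifting rho along the summation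
    map from functions on G/W would express rho(x) as a sum over U-orbits of
    G/W, which all have length [U : W], of a function constant on these orbits;
    so rho(x) would vanish.

    Given K and theta with trace theta = id, let lambda be a k-linear
    projection onto the span of the finite orbit of some x. The trace of
    theta lambda fixes x and has finite rank, so Fitting's lemma turns it into
    an idempotent of finite rank fixing x ([fitting_idempotent]). One of
    minimal rank is primitive, that is, its image is indecomposable. Finally
    take a maximal independent family of such images, by Zorn. Their direct sum
    again satisfies Higman's criterion, so it splits off from P, and a nonzero
    complement would contain a further member ([decomposition]). The members
    are modules over G/H for H contained in K, and such H again have order
    prime to p. *)

(** * Open normal subgroups of a compact group *)

Section OpenNormal.
Variable G : topologicalGroupType.
Implicit Types (g h x : G) (U V W : openNormal G).

Lemma near_mulVgl (A : set G) x : nbhs (1%g : G) A ->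
  \forall y \near x, A (x^-1 * y)%g.
Proof.
move=> A1; have : (fun y => (x^-1 * y)%g) @ x --> (1%g : G).
  rewrite -[X in _ --> X](mulVg x).
  apply: (@continuous_comp _ _ _ (fun y : G => (x^-1%g, y))
    (fun xy : G * G => (xy.1 * xy.2)%g) x); last exact: mulg_continuous.
  by apply: cvg_pair; [exact: (@cvg_cst G)|exact: cvg_id].
by move/(_ _ A1).
Qed.

Lemma openNormal_nbhs U : nbhs (1%g : G) U.
Proof.
by apply: open_nbhs_nbhs; split; [exact: openNormal_open|exact: openNormal1].
Qed.

Lemma openNormalI_subproof U V :
  [/\ (U `&` V) (1%g : G),
      forall x y, (U `&` V) x -> (U `&` V) y -> (U `&` V) (x * y)%g,
      forall x, (U `&` V) x -> (U `&` V) (x^-1)%g,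
      forall x y, (U `&` V) x -> (U `&` V) (x ^ y)%g &
      open (U `&` V)].
Proof.
split; first by split; exact: openNormal1.
- by move=> x y [? ?] [? ?]; split; exact: openNormalM.
- by move=> x [? ?]; split; exact: openNormalV.
- by move=> x y [? ?]; split; exact: openNormalJ.
- by apply: openI; exact: openNormal_open.
Qed.

Definition openNormalI U V : openNormal G :=
  let: And5 P1 PM PV PJ PO := openNormalI_subproof U V in
  OpenNormal P1 PM PV PJ PO.

Lemma openNormalIE U V g : openNormal_set (openNormalI U V) g <->
  openNormal_set U g /\ openNormal_set V g.
Proof. by rewrite /openNormalI; case: openNormalI_subproof. Qed.

Hypothesis Gcompact : compact [set: G].

(** By compactness (the tube lemma for the continuous map (w, x) |-> w ^ x),
    the intersection of all conjugates of [S] is still a neighbourhood of 1. *)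
Lemma open_normal_core (S : set G) : S 1%g ->
  (forall x y, S x -> S y -> S (x * y)%g) -> (forall x, S x -> S (x^-1)%g) ->
  nbhs (1%g : G) S -> exists W : openNormal G, W `<=` S.
Proof.
move=> S1 SM SV nS.
pose C : set G := [set w | forall x, S (w ^ x)%g].
have nC : nbhs (1%g : G) C.
  suff : \forall w \near (1%g : G), [set: G] `<=` (fun x => S (w ^ x)%g).
    by apply: filterS => w Cw x; exact: Cw.
  have /compact_near_coveringP covG := Gcompact.
  apply: covG => x _.
  have cf : continuous (fun xw : G * G => (xw.1^-1 * (xw.2 * xw.1))%g).
      move=> xw; apply: (@continuous_comp _ _ _
          (fun xw : G * G => (xw.1^-1%g, (xw.2 * xw.1)%g))
          (fun xy : G * G => (xy.1 * xy.2)%g)); last exact: mulg_continuous.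
      apply: cvg_pair.
        by apply: continuous_comp; [exact: cvg_fst|exact: invg_continuous].
      apply: (@continuous_comp _ _ _ (fun xw : G * G => (xw.2, xw.1))
        (fun xy : G * G => (xy.1 * xy.2)%g)); last exact: mulg_continuous.
      by apply: cvg_pair; [exact: cvg_snd|exact: cvg_fst].
    have := cf (x, 1%g) S; rewrite /= mul1g mulVg => /(_ nS).
    case=> -[A B] /= [Ax B1] AB; exists (A, B); first by split.
    by move=> [y w] /= ABw; rewrite conjgE; exact: (AB (y, w)).
have C1 : C 1%g by move=> x; rewrite conj1g.
have CM x y : C x -> C y -> C (x * y)%g.
  by move=> Cx Cy z; rewrite conjMg; exact: SM.
have CV x : C x -> C (x^-1)%g by move=> Cx z; rewrite conjVg; exact: SV.
have CJ x y : C x -> C (x ^ y)%g by move=> Cx z; rewrite -conjgM.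
have CO : open C.
  rewrite openE => x Cx; rewrite /interior.
  apply: filterS (near_mulVgl x nC) => y Cy.
  by rewrite -[y](mulVKg x); exact: CM.
by exists (OpenNormal C1 CM CV CJ CO) => x /(_ 1%g); rewrite conjg1.
Qed.

(** The finite sets of cosets form a directed family, so compactness provides
    one of them containing the cosets of all elements of [G]. *)
Lemma quotient_finite W : finite_set [set: quotient_group W].
Proof.
pose F := filter_from [set: {fset quotient_group W}]
  (fun s => [set t | (s `<=` t)%fset]).
have FF : Filter F.
  apply: filter_from_filter; first by exists fset0.
  move=> s t _ _; exists (s `|` t)%fset => // u /= stu; split.
    exact: fsubset_trans (fsubsetUl _ _) stu.
  exact: fsubset_trans (fsubsetUr _ _) stu.
have /compact_near_coveringP covG := Gcompact.
have [s _ /(_ s (fsubset_refl s)) sP] :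
    \forall t \near F, [set: G] `<=` (fun x => coset W x \in t).
  apply: covG => x _.
  exists ([set y | openNormal_set W (x^-1 * y)%g],
          [set t | ([fset coset W x] `<=` t)%fset]).
    split; first exact: near_mulVgl (openNormal_nbhs W).
    by exists [fset coset W x]%fset.
  by case=> y t /= [/coset_eqP <-]; rewrite fsub1set.
apply/finite_fsetP; exists s; apply/seteqP; split=> // q _ /=.
by have [x <-] := coset_surj q; exact: sP.
Qed.

End OpenNormal.

(** * Sums over cosets *)

Section CosetSums.
Variable G : topologicalGroupType.
Implicit Types (g h x : G) (U V W : openNormal G).

Definition coset_repr U (q : quotient_group U) : G := sval (cid (coset_surj q)).

Lemma coset_reprK U (q : quotient_group U) : coset U (coset_repr q) = q.
Proof. exact: svalP (cid (coset_surj q)). Qed.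

Lemma coset_mulr U g w : openNormal_set U w -> coset U (g * w)%g = coset U g.
Proof. by move=> Uw; apply/esym/coset_eqP; rewrite mulKg. Qed.

Lemma coset_eq1 U g : coset U g = 1%g <-> openNormal_set U g.
Proof.
rewrite -coset1; split=> [/esym/coset_eqP|Ug].
  by rewrite invg1 mul1g.
by rewrite -[g]mul1g coset_mulr.
Qed.

Definition right_invariant (A : Type) U (F : G -> A) :=
  forall g w, openNormal_set U w -> F (g * w)%g = F g.

Lemma right_invariant_coset (A : Type) U (F : G -> A) g h :
  right_invariant U F -> coset U g = coset U h -> F g = F h.
Proof. by move=> FU /coset_eqP /(FU g); rewrite mulVKg. Qed.

Lemma right_invariant_mem U V : U `<=` V ->
  right_invariant U (fun g => `[< openNormal_set V g >] : nat).
Proof.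
move=> UV g w /UV Vw; congr (nat_of_bool _); apply/asboolP/asboolP => [Vgw|Vg].
  by have := openNormalM Vgw (openNormalV Vw); rewrite mulgK.
exact: openNormalM.
Qed.

Definition coset_sum (A : nmodType) U (F : G -> A) : A :=
  \sum_(q <- fset_set [set: quotient_group U]) F (coset_repr q).

(** The index of [U] in [V] when [U] is contained in [V]. *)
Definition subindex U V : nat :=
  coset_sum U (fun g => `[< openNormal_set V g >] : nat).

Lemma eq_coset_sum (A : nmodType) U (F1 F2 : G -> A) :
  F1 =1 F2 -> coset_sum U F1 = coset_sum U F2.
Proof. by move=> F12; apply: eq_bigr => q _. Qed.

Lemma coset_sum_linear (k : fieldType) (A B : lmodType k) (f : {linear A -> B})
  U (F : G -> A) : f (coset_sum U F) = coset_sum U (f \o F).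
Proof. exact: linear_sum. Qed.

Section Translation.
Variable U : openNormal G.
Hypothesis finU : finite_set [set: quotient_group U].

Lemma mem_cosets (q : quotient_group U) :
  q \in fset_set [set: quotient_group U].
Proof. by rewrite in_fset_set // inE. Qed.

Lemma coset_sum_translate (A : nmodType) (F : G -> A) h :
  right_invariant U F -> coset_sum U (fun g => F (h * g)%g) = coset_sum U F.
Proof.
move=> FU; set s := enum_fset (fset_set [set: quotient_group U]).
have perm_s : perm_eq s [seq (coset U h * q)%g | q <- s].
  apply: uniq_perm; rewrite ?map_inj_uniq ?fset_uniq //; first exact: mulgI.
  move=> q; rewrite mem_cosets; apply/esym/mapP.
  by exists ((coset U h)^-1 * q)%g; rewrite ?mem_cosets ?mulVKg.
rewrite /coset_sum -/s [RHS](perm_big _ perm_s) big_map.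
apply: eq_bigr => q _; apply: right_invariant_coset FU _.
by rewrite cosetM !coset_reprK.
Qed.

Lemma coset_sum_delta (A : nmodType) (q0 : quotient_group U) (a : A) :
  coset_sum U (fun g => if coset U g == q0 then a else 0) = a.
Proof.
rewrite /coset_sum (big_rem q0) ?mem_cosets //= coset_reprK eqxx.
rewrite big_seq big1 ?addr0 // => q; rewrite mem_rem_uniq ?fset_uniq // !inE.
by rewrite coset_reprK => /andP[/negPf->].
Qed.

Lemma subindex_refl : subindex U U = 1%N.
Proof.
rewrite -[RHS](coset_sum_delta 1%g); apply: eq_coset_sum => g.
case: eqVneq => [/coset_eq1 Ug|nUg]; first by rewrite asboolT.
by rewrite asboolF // => /coset_eq1 Ug; case/eqP: nUg.
Qed.

(** Each coset of [V] splits into equally many cosets of [U], by translation. *)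
Lemma coset_sum_refine (A : nmodType) V (F : G -> A) :
  finite_set [set: quotient_group V] -> U `<=` V -> right_invariant V F ->
  coset_sum U F = coset_sum V F *+ subindex U V.
Proof.
move=> finV UV FV.
have -> : coset_sum U F = coset_sum U (fun g =>
    \sum_(r <- fset_set [set: quotient_group V])
      F (coset_repr r) *+ (coset V g == r)).
  apply: eq_coset_sum => g; rewrite (big_rem (coset V g)) /=; last first.
    by rewrite in_fset_set // inE.
  rewrite eqxx mulr1n big_seq big1 ?addr0.
    by apply: right_invariant_coset FV _; rewrite coset_reprK.
  move=> r; rewrite mem_rem_uniq ?fset_uniq // !inE eq_sym.
  by case/andP=> /negPf->.
rewrite /coset_sum exchange_big /= -sumrMnl; apply: eq_bigr => r _.
rewrite sumrMnr; congr (_ *+ _).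
rewrite -[LHS]/(coset_sum U (fun g => (coset V g == r) : nat)).
rewrite -(@coset_sum_translate _ _ (coset_repr r)); last first.
  by move=> g w /UV Vw; rewrite coset_mulr.
apply: eq_coset_sum => g; congr (nat_of_bool _).
rewrite cosetM coset_reprK.
apply/eqP/asboolP => [rg|/coset_eq1 ->]; last exact: mulg1.
by apply/coset_eq1/(mulgI r); rewrite mulg1.
Qed.

End Translation.

Lemma subindexM U V W : compact [set: G] -> U `<=` V -> V `<=` W ->
  subindex U W = (subindex V W * subindex U V)%N.
Proof.
move=> Gcompact UV VW.
have fin U' := @quotient_finite G Gcompact U'.
rewrite [LHS](coset_sum_refine (fin U) (fin V) UV (right_invariant_mem VW)).
by rewrite -mulr_natr natn.
Qed.

End CosetSums.

(** * The order of an open normal subgroup *)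

Lemma supernatural_lcm0P (A : set nat) l :
  supernatural_lcm A l = Some 0%N <-> forall a, A a -> logn l a = 0%N.
Proof.
rewrite /supernatural_lcm; case: pselect => [bnd|nbnd]; last first.
  split=> // A0; case: nbnd; exists 0%N; apply/asboolP => a /A0 ->; exact: leqnn.
case: ex_minnP => m /asboolP Am m_min; split=> [[m0] a /Am|A0].
  by rewrite m0 leqn0 => /eqP.
congr Some; apply/eqP; rewrite -leqn0; apply: m_min.
by apply/asboolP => a /A0 ->.
Qed.

Section Order.
Variable G : topologicalGroupType.
Implicit Types (H U V W : openNormal G).

Section Restriction.
Variables H W : openNormal G.

Lemma restrict_subproof :
  let S := @subgroup_val G H @^-1` W in
  [/\ S 1%g, forall x y, S x -> S y -> S (x * y)%g,
      forall x, S x -> S (x^-1)%g, forall x y, S x -> S (x ^ y)%g & open S].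
Proof.
move=> S; split; rewrite /S /=; first exact: openNormal1.
- by move=> x y; exact: openNormalM.
- by move=> x; exact: openNormalV.
- move=> x y Sx.
  have -> : subgroup_val (x ^ y)%g = (subgroup_val x ^ subgroup_val y)%g by [].
  exact: openNormalJ.
- apply: open_comp; last exact: openNormal_open.
  by move=> x _; exact: subgroup_val_continuous.
Qed.

Definition restrict : openNormal (subgroup H) :=
  let: And5 P1 PM PV PJ PO := restrict_subproof in OpenNormal P1 PM PV PJ PO.

Lemma restrictE (x : subgroup H) :
  openNormal_set restrict x <-> openNormal_set W (subgroup_val x).
Proof. by rewrite /restrict; case: restrict_subproof. Qed.

Hypothesis finW : finite_set [set: quotient_group W].
Hypothesis WH : W `<=` H.

Let f (q : quotient_group restrict) : quotient_group W :=
  coset W (subgroup_val (coset_repr q)).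

Let f_inj : injective f.
Proof.
move=> q r /coset_eqP qr; rewrite -[q]coset_reprK -[r]coset_reprK.
by apply/coset_eqP/restrictE.
Qed.

Lemma restrict_finite : finite_set [set: quotient_group restrict].
Proof.
rewrite -(preimage_setT f); apply: finite_preimage finW.
by move=> x y _ _; exact: f_inj.
Qed.

(** This connects the order of [H], computed inside the topological group [H],
    with sums over cosets in [G]. *)
Lemma card_restrict :
  ([set: quotient_group restrict] #= `I_(subindex W H))%card.
Proof.
have [n cn] := restrict_finite; suff -> : subindex W H = n by [].
set b := fun q : quotient_group W => `[< openNormal_set H (coset_repr q) >].
set sW := enum_fset (fset_set [set: quotient_group W]).
have -> : subindex W H = count b sW.
  rewrite -sum1_count big_mkcond /=; apply: eq_bigr => q _.
  by rewrite /b; case: asbool.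
rewrite -(card_fset_set cn) -size_filter -(size_map f).
apply: perm_size; apply: uniq_perm.
- by rewrite filter_uniq ?fset_uniq.
- by rewrite map_inj_uniq ?fset_uniq.
move=> q; rewrite mem_filter mem_cosets // andbT; apply/asboolP/mapP => [Hq|].
  exists (coset restrict (subgroup_sub Hq)).
    by rewrite mem_cosets //; exact: restrict_finite.
  rewrite -[LHS]coset_reprK; apply/coset_eqP.
  pose r := coset_repr (coset restrict (subgroup_sub Hq)).
  suff /coset_eqP/restrictE :
    coset restrict (subgroup_sub Hq) = coset restrict r by [].
  by rewrite coset_reprK.
move=> [r _ ->]; have := subgroup_valP (coset_repr r).
set h := subgroup_val _ => Hh.
have /coset_eqP /WH Hhq : coset W h = coset W (coset_repr (coset W h)).
  by rewrite coset_reprK.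
by have := openNormalM Hh Hhq; rewrite mulVKg.
Qed.

End Restriction.

Variables (k : fieldType) (p : nat).
Hypotheses (charkp : has_characteristic k p) (Gcompact : compact [set: G]).

Lemma order_prime_to_subindex H W : order_prime_to p (subgroup H) ->
  W `<=` H -> (subindex W H)%:R != 0 :> k.
Proof.
move=> Hp WH; have finW := @quotient_finite _ Gcompact W.
have card_W := card_restrict finW WH.
have n0 : subindex W H != 0%N.
  apply/eqP => n0; move: card_W; rewrite n0 II0 card_eq0 => /eqP.
  by move/seteqP => [/(_ 1%g I)].
move: charkp; rewrite /has_characteristic; case: eqP => [_ /pcharf0P->//|p0 pk].
case: Hp => // /supernatural_lcm0P/(_ (subindex W H)) logn0.
rewrite -(dvdn_pcharf pk) -[p]expn1 pfactor_dvdn ?lt0n ?(pcharf_prime pk) //.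
by rewrite logn0 //; exists (restrict H W).
Qed.

(** The open normal subgroup of [U] witnessing that [p] divides the order need
    not be normal in [G]. Its core in [G] is, and the index of the core is a
    multiple of the index of the witness. *)
Lemma subindex_eq0 U : ~ order_prime_to p (subgroup U) ->
  exists2 W : openNormal G, W `<=` U & (subindex W U)%:R = 0 :> k.
Proof.
move=> nUp; have p0 : p <> 0%N by move=> p0; apply: nUp; left.
have pk : p \in [pchar k].
  by move: charkp; rewrite /has_characteristic; case: eqP.
have [U' [n [cn pn]]] : exists (U' : openNormal (subgroup U)) n,
    ([set: quotient_group U'] #= `I_n)%card /\ (p %| n)%N.
  apply: contrapT => nU'; apply: nUp; right; apply/supernatural_lcm0P.
  move=> n [U' cn]; apply/eqP; rewrite eqn0Ngt logn_gt0 mem_primes.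
  by apply/negP => /and3P[_ _ pn]; apply: nU'; exists U', n.
pose S : set G := [set g | exists2 x, openNormal_set U' x & g = subgroup_val x].
have nS : nbhs (1%g : G) S.
  have [O Oo OU'] : exists2 O : set G, open O & @subgroup_val G U @^-1` O = U'.
    exact: openNormal_open U'.
  have O1 : O 1%g.
    by have := openNormal1 U'; rewrite -OU'.
  have nO : nbhs (1%g : G) O by apply: open_nbhs_nbhs.
  apply: filterS2 nO (openNormal_nbhs U) => g Og Ug.
  by exists (subgroup_sub Ug) => //; rewrite -OU'.
have [|||W WS] := open_normal_core Gcompact (S := S) _ _ _ nS.
- by exists 1%g => //; exact: openNormal1.
- move=> _ _ [x Ux ->] [y Uy ->]; exists (x * y)%g => //; exact: openNormalM.
- move=> _ [x Ux ->]; exists (x^-1)%g => //; exact: openNormalV.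
have WU : W `<=` U by move=> g /WS[x _ ->]; exact: subgroup_valP.
exists W => //; apply/eqP; rewrite -(dvdn_pcharf pk).
have finW := @quotient_finite _ Gcompact W.
have finWU := @restrict_finite U W finW.
have resU' : restrict U W `<=` U'.
  by move=> x /restrictE /WS[y U'y /subgroup_val_inj->].
have finU' : finite_set [set: quotient_group U'] by exists n.
have := coset_sum_refine finWU finU' resU' (F := fun=> 1%N)
  (fun _ _ _ => erefl).
rewrite /coset_sum !sum1_size (card_fset_set cn).
rewrite (card_fset_set (card_restrict finW WU)) => ->.
by rewrite -mulr_natr dvdn_mulr.
Qed.

End Order.

(** * Complements of subspaces *)

Definition linear_of (R : nzRingType) (U V : lmodType R) (f : U -> V)
    (lf : linear f) : {linear U -> V} :=
  HB.pack f (GRing.isLinear.Build R U V *:%R f lf).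

Section LinearAlgebra.
Variable k : fieldType.

Definition is_subspace (V : lmodType k) (S : set V) :=
  S 0 /\ forall (a : k) u v, S u -> S v -> S (a *: u + v).

Section Subspace.
Variables (V : lmodType k) (S : set V).
Hypothesis subS : is_subspace S.

Lemma subspaceD u v : S u -> S v -> S (u + v).
Proof. by move=> Su Sv; rewrite -[u]scale1r; exact: subS.2. Qed.

Lemma subspaceZ a u : S u -> S (a *: u).
Proof.
by move=> Su; rewrite -[_ *: _]addr0; apply: subS.2 => //; exact: subS.1.
Qed.

Lemma subspaceN u : S u -> S (- u).
Proof. by move=> Su; rewrite -scaleN1r; exact: subspaceZ. Qed.

Lemma subspaceB u v : S u -> S v -> S (u - v).
Proof. by move=> Su Sv; rewrite addrC -scaleN1r; exact: subS.2. Qed.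
End Subspace.

(** A maximal subspace [T] meeting [S] trivially is a complement: otherwise a
    vector outside of [S + T] could be adjoined to it. *)
Lemma complement_exists (V : lmodType k) (S : set V) : is_subspace S ->
  exists T : set V, [/\ is_subspace T, forall v, S v -> T v -> v = 0 &
    forall v, exists2 s, S s & T (v - s)].
Proof.
move=> subS.
(* The empty set must qualify, as the union of the empty chain. *)
pose P (T : set V) := (forall (a : k) u v, T u -> T v -> T (a *: u + v)) /\
  forall v, S v -> T v -> v = 0.
have [F FP totF|T [[TP TS] Tmax]] := @Zorn_bigcup V P.
  split=> [a u v [A FA Au] [B FB Bv]|v Sv [A FA Av]]; last exact: (FP A FA).2.
  have [AB|BA] := totF A B FA FB.
    by exists B => //; apply: (FP B FB).1 => //; exact: AB.
  by exists A => //; apply: (FP A FA).1 => //; exact: BA.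
have T0 : T 0.
  apply: contrapT => nT0; apply: (Tmax [set 0]).
    split=> [v Tv|/(_ 0 erefl) //].
    by case: nT0; have := TP (-1) v v Tv Tv; rewrite scaleN1r addNr.
  split=> [a _ _ -> ->|v _ -> //]; by rewrite scaler0 addr0.
have subT : is_subspace T by [].
exists T; split=> // v; apply: contrapT => nST.
pose B := [set w | exists c, T (w - c *: v)].
apply: (Tmax B).
  split=> [w Tw|BT]; first by exists 0; rewrite scale0r subr0.
  apply: nST; exists 0; first exact: subS.1.
  by rewrite subr0; apply: BT; exists 1; rewrite scale1r subrr.
split=> [a u w [c Tu] [d Tw]|w Sw [c Tw]].
  exists (a * c + d); have := TP a _ _ Tu Tw.
  by rewrite scalerBr scalerA addrACA -opprD -scalerDl.
have [c0|c0] := eqVneq c 0.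
  by apply: TS => //; move: Tw; rewrite c0 scale0r subr0.
case: nST; exists (c^-1 *: w); first exact: subspaceZ.
have := subspaceZ subT (- c^-1) Tw.
by rewrite scalerBr scalerA mulNr mulVf // scaleN1r opprK scaleNr addrC.
Qed.

Lemma linear_kernel (U V : lmodType k) (f : {linear U -> V}) :
  is_subspace [set u | f u = 0].
Proof.
by split=> [|a u v /= fu fv]; rewrite /= ?linear0 // linearP fu fv scaler0 addr0.
Qed.

Lemma linear_range (U V : lmodType k) (f : {linear U -> V}) :
  is_subspace (range f).
Proof.
split=> [|a _ _ [u _ <-] [v _ <-]]; first by exists 0; rewrite ?linear0.
by exists (a *: u + v); rewrite ?linearP.
Qed.

(** A section when [f] is onto and a retraction when [f] is one-to-one. *)
Lemma linear_regular (U V : lmodType k) (f : {linear U -> V}) :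
  exists s : {linear V -> U}, forall u, f (s (f u)) = f u.
Proof.
have [T [subT kerT compT]] := complement_exists (linear_kernel f).
have [R [subR imR compR]] := complement_exists (linear_range f).
have ex v : exists u, T u /\ R (v - f u).
  have [_ [u _ <-] Rv] := compR v; have [w /= fw Tu] := compT u.
  by exists (u - w); split; rewrite // linearB fw subr0.
have uniq v u w : T u -> R (v - f u) -> T w -> R (v - f w) -> u = w.
  move=> Tu Ru Tw Rw; apply/subr0_eq; apply: kerT; last exact: subspaceB.
  apply: imR; first by exists (u - w).
  have -> : f (u - w) = (v - f w) - (v - f u).
    by rewrite linearB opprB [RHS]addrC subrKA.
  exact: subspaceB.
pose s v := sval (cid (ex v)).
have sP v : T (s v) /\ R (v - f (s v)) := svalP (cid (ex v)).
have s_lin : linear s.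
  move=> a v w.
  apply: (uniq (a *: v + w)); try exact: (sP _).1; try exact: (sP _).2.
    by apply: subT.2; exact: (sP _).1.
  have -> : a *: v + w - f (a *: s v + s w) =
      a *: (v - f (s v)) + (w - f (s w)).
    by rewrite linearP scalerBr opprD addrACA.
  by apply: subR.2; exact: (sP _).2.
exists (linear_of s_lin) => u /=; apply/esym/subr0_eq.
apply: imR; last exact: (sP _).2.
by exists (u - s (f u)); rewrite ?linearB.
Qed.

End LinearAlgebra.

(** * Averaging over the group *)

Section Homs.
Variables (k : fieldType) (G : topologicalGroupType).
Implicit Types (L M N : discreteModule k G) (U V K : openNormal G).

Lemma dm_act_sum M g (I : Type) (s : seq I) (P : pred I) (F : I -> M) :
  dm_act g (\sum_(i <- s | P i) F i) = \sum_(i <- s | P i) dm_act g (F i).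
Proof. exact: (linear_sum (linear_of (dm_act_linear g))). Qed.

Lemma dm_actZ M g a (m : M) : dm_act g (a *: m) = a *: dm_act g m.
Proof. exact: (linearZZ (linear_of (dm_act_linear g))). Qed.

Lemma dm_act0 M g : dm_act g (0 : M) = 0.
Proof. exact: (linear0 (linear_of (dm_act_linear g))). Qed.

Definition is_hom M N (f : M -> N) :=
  linear f /\ forall g m, f (dm_act g m) = dm_act g (f m).

Definition dm_hom_of M N (f : M -> N) (hf : is_hom f) : dm_hom M N :=
  DmHom (dm_fun := linear_of hf.1) hf.2.

Lemma dm_homP M N (f : dm_hom M N) : is_hom f.
Proof. by split=> [a u v|g m]; [exact: linearP|exact: dm_funJ]. Qed.

Lemma is_hom_id M : is_hom (@id M).
Proof. by []. Qed.

Lemma is_hom0 M N : is_hom (fun _ : M => 0 : N).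
Proof.
split=> [a u v|g m]; first by rewrite scaler0 addr0.
by rewrite dm_act0.
Qed.

Lemma is_hom_comp L M N (f : M -> N) (e : L -> M) :
  is_hom f -> is_hom e -> is_hom (f \o e).
Proof.
by move=> [lf Jf] [le Je]; split=> [a u v|g m] /=; rewrite ?le ?lf ?Je ?Jf.
Qed.

Lemma dm_actD M g (m n : M) : dm_act g (m + n) = dm_act g m + dm_act g n.
Proof. exact: (linearD (linear_of (dm_act_linear g))). Qed.

Lemma dm_actB M g (m n : M) : dm_act g (m - n) = dm_act g m - dm_act g n.
Proof. exact: (linearB (linear_of (dm_act_linear g))). Qed.

Lemma dm_actK M g : cancel (@dm_act _ _ M g) (dm_act g^-1%g).
Proof. by move=> m; rewrite -dm_actM mulVg dm_act1. Qed.

Lemma dm_actKV M g : cancel (@dm_act _ _ M g^-1%g) (dm_act g).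
Proof. by move=> m; rewrite -dm_actM mulgV dm_act1. Qed.

Definition fixes U M (m : M) := forall g, openNormal_set U g -> dm_act g m = m.

Lemma fixes_sub U V M (m : M) : U `<=` V -> fixes V m -> fixes U m.
Proof. by move=> UV fVm g /UV; exact: fVm. Qed.

Lemma fixes_act U M g (m : M) : fixes U m -> fixes U (dm_act g m).
Proof.
move=> fUm h Uh; rewrite -dm_actM.
have -> : (h * g = g * h ^ g)%g by rewrite conjgE mulVKg.
by rewrite dm_actM fUm //; exact: openNormalJ.
Qed.

Lemma fixes_right_invariant U M (m : M) : fixes U m ->
  right_invariant U (fun g => dm_act g m).
Proof. by move=> fUm g w Uw; rewrite dm_actM fUm. Qed.

Hypothesis Gcompact : compact [set: G].

Lemma fixes_exists M (m : M) : exists U, fixes U m.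
Proof.
have [|||U US] := open_normal_core Gcompact (S := [set g | dm_act g m = m])
  _ _ _ (dm_stab m).
- exact: dm_act1.
- by move=> g h /= gm hm; rewrite dm_actM hm gm.
- by move=> g /= gm; rewrite -[in LHS]gm dm_actK.

by exists U => g /US.
Qed.

Lemma fixes_seq_exists (K : openNormal G) M (s : seq M) :
  exists2 U : openNormal G, U `<=` K & forall m, m \in s -> fixes U m.
Proof.
elim: s => [|m s [U UK fUs]]; first by exists K.
have [V fVm] := fixes_exists m; exists (openNormalI U V).
  by move=> g /openNormalIE[/UK].
move=> x; rewrite inE => /orP[/eqP->|/fUs fUx].
  by apply: fixes_sub fVm => g /openNormalIE[].
by apply: fixes_sub fUx => g /openNormalIE[].
Qed.

End Homs.

Section Average.
Variables (k : fieldType) (G : topologicalGroupType) (K : openNormal G).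
Hypothesis Gcompact : compact [set: G].

(** Equivalently, [k] carries a translation-invariant measure on [G] giving
    [K] the mass 1: the cosets of a smaller [W] have mass 1 / [K : W]. *)
Definition normalizable :=
  forall W : openNormal G, W `<=` K -> (subindex W K)%:R != 0 :> k.
Hypothesis Knorm : normalizable.

Let fin (W : openNormal G) := @quotient_finite G Gcompact W.

Section Integral.
Variable A : lmodType k.
Implicit Types (F : G -> A) (W V : openNormal G).

Definition resolves W F := W `<=` K /\ right_invariant W F.

Definition average W F : A := (subindex W K)%:R^-1 *: coset_sum W F.

(** Independent of the chosen [W]; the value 0 is a default for functions that
    are not locally constant. *)
Definition integral F : A :=
  if pselect (exists W, resolves W F) is left e then average (sval (cid e)) F
  else 0.

Lemma average_refine W V F :
  W `<=` V -> resolves V F -> average W F = average V F.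
Proof.
move=> WV [VK FV]; have WK : W `<=` K := subset_trans WV VK.
have idxW := subindexM Gcompact WV VK.
rewrite /average (coset_sum_refine (fin W) (fin V) WV FV) -scaler_nat.
rewrite scalerA idxW.
have := Knorm WK; rewrite idxW natrM mulf_eq0 negb_or => /andP[_ nz].
by rewrite invfM -mulrA mulVf // mulr1.
Qed.

Lemma integralE W F : resolves W F -> integral F = average W F.
Proof.
move=> resW; rewrite /integral; case: pselect => [e|[]]; last by exists W.
set V := sval _; have resV : resolves V F := svalP (cid e).
rewrite -(@average_refine (openNormalI W V) V) //.
  by rewrite (@average_refine _ W) // => g /openNormalIE[].
by move=> g /openNormalIE[].
Qed.

End Integral.

Lemma resolves_comp (A B : lmodType k) (f : A -> B) W (F : G -> A) :
  resolves W F -> resolves W (f \o F).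
Proof. by move=> [WK FW]; split=> // g w /(FW g) /= ->. Qed.

Lemma integral_linear (A B : lmodType k) (f : A -> B) W (F : G -> A) :
  linear f -> resolves W F -> f (integral F) = integral (f \o F).
Proof.
move=> lf resF; rewrite (integralE resF) (integralE (resolves_comp f resF)).
rewrite -[f]/(linear_of lf : A -> B) /average.
by rewrite linearZ coset_sum_linear.
Qed.

Lemma eq_integral (A : lmodType k) (F1 F2 : G -> A) :
  F1 =1 F2 -> integral F1 = integral F2.
Proof. by move/funext->. Qed.

Lemma integral_translate (A : lmodType k) W (F : G -> A) h :
  resolves W F -> integral (fun g => F (h * g)%g) = integral F.
Proof.
move=> resF; have resFh : resolves W (fun g => F (h * g)%g).
  by split=> [|g w Ww]; [exact: resF.1|rewrite mulgA (resF.2 _ _ Ww)].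
rewrite (integralE resF) (integralE resFh) /average.
by rewrite coset_sum_translate //; exact: resF.2.
Qed.

Lemma integral_const (A : lmodType k) (a : A) (q0 : quotient_group K) :
  integral (fun g => if coset K g == q0 then a else 0) = a.
Proof.
rewrite (@integralE _ K).
  by rewrite /average subindex_refl // invr1 scale1r coset_sum_delta.
by split=> // g w Kw; rewrite coset_mulr.
Qed.

Section Trace.
Implicit Types (M N : discreteModule k G).

(** For finite [G] and trivial [K] this is the usual relative trace, the sum of
    the conjugates of [theta]. *)
Definition trace M N (theta : M -> N) (m : M) : N :=
  integral (fun g => dm_act g (theta (dm_act g^-1%g m))).

(** The integrand is locally constant: orbits are finite, so it suffices to fix
    the finitely many vectors of [s] and the finitely many values of [theta] on
    their orbits. *)
Lemma trace_resolves M N (theta : M -> N) (s : seq M) :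
  exists W, forall m, m \in s ->
    resolves W (fun g => dm_act g (theta (dm_act g^-1%g m))).
Proof.
have [U UK fUs] := fixes_seq_exists Gcompact K s.
have [W WU fW] := fixes_seq_exists Gcompact U
  [seq theta (dm_act (coset_repr q) m) | m <- s,
     q <- fset_set [set: quotient_group U]].
exists W => m ms; split=> [|g w Ww]; first exact: subset_trans UK.
have fUm := fUs _ ms.
have fUx : fixes U (dm_act g^-1%g m) by exact: fixes_act.
rewrite invgM [dm_act (_ * _)%g m]dm_actM fUx; last first.
  by apply: openNormalV; exact: WU.
rewrite dm_actM; congr dm_act; apply: fW (Ww); apply/allpairsPdep.
exists m, (coset U g^-1%g); split=> //; first exact: mem_cosets.
congr theta; apply: (right_invariant_coset (fixes_right_invariant fUm)).
by rewrite coset_reprK.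
Qed.

Lemma trace_hom M N (theta : M -> N) : linear theta -> is_hom (trace theta).
Proof.
move=> lin; split=> [a u v|h m].
  have [W resW] := trace_resolves theta [:: u; v; a *: u + v].
  rewrite /trace (integralE (resW (a *: u + v) _)) ?inE ?eqxx ?orbT //.
  rewrite (integralE (resW u _)) ?inE ?eqxx //.
  rewrite (integralE (resW v _)) ?inE ?eqxx ?orbT //.
  rewrite /average scalerA mulrC -scalerA -scalerDr; congr (_ *: _).
  rewrite /coset_sum scaler_sumr -big_split /=; apply: eq_bigr => q _.
  by rewrite dm_act_linear lin dm_act_linear.
have [W resW] := trace_resolves theta [:: dm_act h m; m].
have resm : resolves W (fun g => dm_act g (theta (dm_act g^-1%g m))).
  by apply: resW; rewrite !inE eqxx orbT.
have reshm := resW _ (mem_head _ _).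
rewrite /trace -(integral_translate h reshm).
rewrite (integral_linear (@dm_act_linear _ _ _ h) resm).
apply: eq_integral => g /=.
by rewrite dm_actM invgM [dm_act (_ * _)%g _]dm_actM dm_actK.
Qed.

Lemma trace_compl M N N' (f : N -> N') (theta : M -> N) m :
  is_hom f -> f (trace theta m) = trace (f \o theta) m.
Proof.
move=> hf; have [W /(_ m (mem_head _ _)) resm] := trace_resolves theta [:: m].
rewrite /trace (integral_linear hf.1 resm).
by apply: eq_integral => g /=; rewrite hf.2.
Qed.

Lemma trace_compr M' M N (f : M' -> M) (theta : M -> N) m :
  is_hom f -> trace theta (f m) = trace (theta \o f) m.
Proof. by move=> hf; apply: eq_integral => g /=; rewrite hf.2. Qed.

Lemma eq_trace M N (theta eta : M -> N) :
  theta =1 eta -> trace theta =1 trace eta.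
Proof. by move/funext->. Qed.

End Trace.
End Average.

(** * Submodules, quotients and coinduced modules *)

Section Subspaces.
Variables (k : fieldType) (V : lmodType k) (S : set V) (subS : is_subspace S).

Definition subspace_type of is_subspace S : Type := {v : V | `[< S v >]}.
Local Notation T := (subspace_type subS).

HB.instance Definition _ := Choice.on T.

Definition subspace_val (v : T) : V := val v.

Lemma subspace_valP (v : T) : S (subspace_val v).
Proof. by case: v => v Sv; exact/asboolP. Qed.

Lemma subspace_val_inj : injective subspace_val.
Proof. exact: val_inj. Qed.

Definition subspace_sub (v : V) (Sv : S v) : T :=
  exist _ v (introT (asboolP _) Sv).

Let zero := subspace_sub subS.1.
Let opp (u : T) := subspace_sub (subspaceN subS (subspace_valP u)).
Let add (u v : T) :=
  subspace_sub (subspaceD subS (subspace_valP u) (subspace_valP v)).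
Let scale a (u : T) := subspace_sub (subspaceZ subS a (subspace_valP u)).

Let addA : associative add.
Proof. by move=> u v w; apply: subspace_val_inj; exact: addrA. Qed.
Let addC : commutative add.
Proof. by move=> u v; apply: subspace_val_inj; exact: addrC. Qed.
Let add0 : left_id zero add.
Proof. by move=> u; apply: subspace_val_inj; exact: add0r. Qed.
Let addN : left_inverse zero opp add.
Proof. by move=> u; apply: subspace_val_inj; exact: addNr. Qed.

HB.instance Definition _ := GRing.isZmodule.Build T addA addC add0 addN.

Let scaleA a b u : scale a (scale b u) = scale (a * b) u.
Proof. by apply: subspace_val_inj; exact: scalerA. Qed.
Let scale1 : left_id 1 scale.
Proof. by move=> u; apply: subspace_val_inj; exact: scale1r. Qed.
Let scaleDr : right_distributive scale +%R.
Proof. by move=> a u v; apply: subspace_val_inj; exact: scalerDr. Qed.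
Let scaleDl u : {morph scale^~ u : a b / a + b}.
Proof. by move=> a b; apply: subspace_val_inj; exact: scalerDl. Qed.

HB.instance Definition _ := GRing.Zmodule_isLmodule.Build k T
  scaleA scale1 scaleDr scaleDl.

End Subspaces.

Section Submodule.
Variables (k : fieldType) (G : topologicalGroupType) (M : discreteModule k G).
Variables (S : set M) (subS : is_subspace S).
Hypothesis stableS : forall g m, S m -> S (dm_act g m).

Let act g (m : subspace_type subS) : subspace_type subS :=
  subspace_sub subS (stableS g (subspace_valP m)).

Let act_linear g : linear (act g).
Proof. by move=> a u v; apply: subspace_val_inj; exact: dm_act_linear. Qed.
Let act1 m : act 1%g m = m.
Proof. by apply: subspace_val_inj; exact: dm_act1. Qed.
Let actM g h m : act (g * h)%g m = act g (act h m).
Proof. by apply: subspace_val_inj; exact: dm_actM. Qed.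
Let act_continuous : continuous
  (fun gm : G * discrete_topology (subspace_type subS) =>
     act gm.1 gm.2 : discrete_topology (subspace_type subS)).
Proof.
apply: act_continuousP => // m.
apply: filterS (dm_stab (subspace_val m)) => g gm.
exact: subspace_val_inj.
Qed.

Definition submodule : discreteModule k G :=
  DiscreteModule act_linear act1 actM act_continuous.

Lemma submodule_val_hom : is_hom (@subspace_val _ _ _ subS : submodule -> M).
Proof. by []. Qed.

Lemma submodule_sub_hom (N : discreteModule k G) (f : N -> M)
    (fS : forall n, S (f n)) :
  is_hom f -> is_hom (fun n => subspace_sub subS (fS n) : submodule).
Proof.
by move=> [lf Jf]; split=> [a u v|g m]; apply: subspace_val_inj;
  [exact: lf|exact: Jf].
Qed.

End Submodule.

Section Epimorphisms.
Variables (k : fieldType) (G : topologicalGroupType).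
Implicit Types A B C : discreteModule k G.

(** The cokernel of [e] is realized on a linear complement [T] of its image,
    on which [g] acts by acting in [B] and projecting back to [T]. *)
Lemma dm_epi_surj A B (e : dm_hom A B) :
  dm_epi e <-> forall b, exists a, e a = b.
Proof.
split=> [epi_e|surj_e C f g fg b]; last by have [a <-] := surj_e b.
have [s es] := linear_regular e.
pose pi b := b - e (s b).
have pi_lin : linear pi.
  by move=> a u v; rewrite /pi (linearP s) (linearP e) scalerBr opprD addrACA.
have pi_e a : pi (e a) = 0 by rewrite /pi es subrr.
have piK b : pi (pi b) = pi b.
  rewrite -[LHS]/(pi b - e (s (pi b))) (_ : e (s (pi b)) = 0) ?subr0 //.
  by rewrite /pi (linearB s) (linearB e) es subrr.
have pi_act g b : pi (dm_act g (pi b)) = pi (dm_act g b).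
  have -> : dm_act g (pi b) = dm_act g b - e (dm_act g (s b)).
    by rewrite dm_funJ -dm_actB.
  have -> x y : pi (x - y) = pi x - pi y by exact: (linearB (linear_of pi_lin)).
  by rewrite pi_e subr0.
pose T : set B := [set b | pi b = b].
have subT : is_subspace T.
  split=> [|a u v Tu Tv]; first exact: (linear0 (linear_of pi_lin)).
  by rewrite /T /= pi_lin Tu Tv.
pose act g (b : subspace_type subT) : subspace_type subT :=
  subspace_sub subT (piK (dm_act g (subspace_val b))).
have act_linear g : linear (act g).
  move=> a u v; apply: subspace_val_inj.
  by rewrite /subspace_val /= dm_act_linear pi_lin.
have act1 b : act 1%g b = b.
  by apply: subspace_val_inj; rewrite /subspace_val /= dm_act1 (subspace_valP b).
have actM g h b : act (g * h)%g b = act g (act h b).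
  by apply: subspace_val_inj; rewrite /subspace_val /= dm_actM pi_act.
have act_cont : continuous
  (fun gm : G * discrete_topology (subspace_type subT) =>
     act gm.1 gm.2 : discrete_topology (subspace_type subT)).
  apply: act_continuousP => // b.
  apply: filterS (dm_stab (subspace_val b)) => g gb; apply: subspace_val_inj.
  by rewrite /subspace_val /= [X in pi X]gb (subspace_valP b).
pose C := DiscreteModule act_linear act1 actM act_cont.
pose f b : C := subspace_sub subT (piK b).
have hf : is_hom f.
  split=> [a u v|g m]; apply: subspace_val_inj; rewrite /subspace_val /=.
    exact: pi_lin.
  by rewrite pi_act.
move=> b; have /(congr1 (@subspace_val _ _ _ _)) : f b = 0.
  apply: (epi_e C (dm_hom_of hf) (dm_hom_of (is_hom0 B C))) => a.
  by apply: subspace_val_inj; exact: pi_e.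
by move/subr0_eq ->; exists (s b).
Qed.

End Epimorphisms.

Section Coinduced.
Variables (k : fieldType) (G : topologicalGroupType) (W : openNormal G).
Hypothesis Gcompact : compact [set: G].
Variable N : discreteModule k G.

Definition coinduced_type : Type := quotient_group W -> N.
HB.instance Definition _ :=
  GRing.Lmodule.copy coinduced_type (quotient_group W -> N).

Let act g (f : coinduced_type) : coinduced_type :=
  fun q => dm_act g (f ((coset W g)^-1 * q)%g).

Let act_linear g : linear (act g).
Proof. by move=> a u v; apply/funext => q; exact: dm_act_linear. Qed.
Let act1 f : act 1%g f = f.
Proof. by apply/funext => q; rewrite /act dm_act1 coset1 invg1 mul1g. Qed.
Let actM g h f : act (g * h)%g f = act g (act h f).
Proof. by apply/funext => q; rewrite /act dm_actM cosetM invgM mulgA. Qed.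
Let act_continuous : continuous
  (fun gm : G * discrete_topology coinduced_type =>
     act gm.1 gm.2 : discrete_topology coinduced_type).
Proof.
apply: act_continuousP => // f.
have [U UW fU] := fixes_seq_exists Gcompact W
  [seq f q | q <- fset_set [set: quotient_group W]].
apply: filterS (openNormal_nbhs U) => g Ug; apply/funext => q; rewrite /act.
have /coset_eq1 -> : openNormal_set W g by exact: UW.
rewrite invg1 mul1g fU //; apply: map_f; rewrite mem_cosets //.
exact: quotient_finite.
Qed.

Definition coinduced : discreteModule k G :=
  DiscreteModule act_linear act1 actM act_continuous.

Lemma coinduced_actE g (f : coinduced) q :
  dm_act g f q = dm_act g (f ((coset W g)^-1 * q)%g).
Proof. by []. Qed.

Definition coinduced_sum (f : coinduced) : N :=
  coset_sum W (fun g => f (coset W g)).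

Definition coinduced_delta (q0 : quotient_group W) (n : N) : coinduced :=
  fun q => if q == q0 then n else 0.

(** The action on functions also moves the values, which is what makes
    summation over all cosets equivariant. *)
Lemma coinduced_sum_hom : is_hom coinduced_sum.
Proof.
split=> [a u v|h f].
  rewrite /coinduced_sum /coset_sum scaler_sumr -big_split.
  by apply: eq_bigr => q _.
rewrite /coinduced_sum [RHS]dm_act_sum.
rewrite -[LHS](@coset_sum_translate _ _ (@quotient_finite _ Gcompact W) _ _ h).
  by apply: eq_bigr => q _; rewrite coinduced_actE cosetM mulKg.
by move=> g w Ww; rewrite coset_mulr.
Qed.

Lemma coinduced_sum_delta q0 n : coinduced_sum (coinduced_delta q0 n) = n.
Proof. exact: (coset_sum_delta (@quotient_finite _ Gcompact W)). Qed.

End Coinduced.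

(** * Modules over the quotients *)

Section Deflation.
Variables (k : fieldType) (G : topologicalGroupType) (H : openNormal G).
Variables (M : discreteModule k G) (fixM : forall m : M, fixes H m).

(** The proof is kept as a parameter of the type so that the scaling, which
    depends on it, can be attached canonically. *)
Definition deflation_type of (forall m : M, fixes H m) : Type := M.
Local Notation D := (deflation_type fixM).
Local Notation kQ := (group_algebra k (quotient_group H)).
HB.instance Definition _ := GRing.Zmodule.copy D M.

Let scale (a : kQ) (m : D) : D :=
  \sum_(q <- msupp a) a@_q *: dm_act (coset_repr q) (m : M).

Let act_repr g (m : M) : dm_act (coset_repr (coset H g)) m = dm_act g m.
Proof.
apply: (right_invariant_coset (fixes_right_invariant (fixM m))).
by rewrite coset_reprK.
Qed.

Let scalew (d : {fset quotient_group H}) (a : kQ) m : (msupp a `<=` d)%fset ->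
  scale a m = \sum_(q <- d) a@_q *: dm_act (coset_repr q) (m : M).
Proof.
move=> ad; rewrite /scale (big_fset_incl _ ad) // => q _ /mcoeff_outdom ->.
by rewrite scale0r.
Qed.

Let scaleU x g m : scale (gaU x (coset H g)) m = x *: dm_act g (m : M).
Proof.
by rewrite (scalew _ msuppU_le) big_seq_fset1 mcoeffUU act_repr.
Qed.

Let scaleDl m : {morph scale^~ m : a b / a + b}.
Proof.
move=> a b; rewrite (scalew _ (msuppD_le a b)).
rewrite (scalew _ (fsubsetUl _ (msupp b))) (scalew _ (fsubsetUr (msupp a) _)).
by rewrite -big_split; apply: eq_bigr => q _; rewrite mcoeffD scalerDl.
Qed.

Let scaleDr : right_distributive scale +%R.
Proof.
move=> a m n; rewrite /scale -big_split; apply: eq_bigr => q _.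
by rewrite dm_actD scalerDr.
Qed.

Let scale_suml (I : Type) (s : seq I) (F : I -> kQ) m :
  scale (\sum_(i <- s) F i) m = \sum_(i <- s) scale (F i) m.
Proof.
apply: (big_morph (scale^~ m) (scaleDl m)).
by rewrite /scale msupp0 big_seq_fset0.
Qed.

Let scale_sumr (I : Type) (s : seq I) (F : I -> D) a :
  scale a (\sum_(i <- s) F i) = \sum_(i <- s) scale a (F i).
Proof.
apply: (big_morph (scale a) (scaleDr a)).
by rewrite /scale big1 // => q _; rewrite dm_act0 scaler0.
Qed.

Let scaleA a b m : scale a (scale b m) = scale (a * b) m.
Proof.
rewrite (gaE a) mulr_suml !scale_suml; apply: eq_bigr => q _.
rewrite (gaE b) mulr_sumr !scale_suml scale_sumr; apply: eq_bigr => r _.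
rewrite gaUM -[q]coset_reprK -[r]coset_reprK -cosetM !scaleU.
by rewrite dm_actZ scalerA dm_actM.
Qed.

Let scale1 : left_id 1 scale.
Proof. by move=> m; rewrite -ga1 -coset1 scaleU dm_act1 scale1r. Qed.

HB.instance Definition _ := GRing.Zmodule_isLmodule.Build kQ D
  scaleA scale1 scaleDr scaleDl.

Definition deflation : lmodType kQ := D.

Lemma deflation_scaleE x g (m : M) :
  gaU x (coset H g) *: (m : deflation) = x *: dm_act g m.
Proof. exact: scaleU. Qed.

Lemma inflation_deflation_hom : is_hom (fun m : M => m : inflation deflation).
Proof.
split=> [a u v|g m]; last by rewrite inflation_actE deflation_scaleE scale1r.
by rewrite underlying_scaleE -coset1 deflation_scaleE dm_act1.
Qed.

Lemma deflation_inflation_hom : is_hom (fun m : inflation deflation => m : M).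
Proof.
split=> [a u v|g m]; last by rewrite inflation_actE deflation_scaleE scale1r.
by rewrite underlying_scaleE -coset1 deflation_scaleE dm_act1.
Qed.

End Deflation.

Section Inflation.
Variables (k : fieldType) (G : topologicalGroupType) (H : openNormal G).
Local Notation kQ := (group_algebra k (quotient_group H)).

Lemma group_algebra_linearP (V W : lmodType kQ) (f : V -> W) :
  linear f <-> is_hom (f : inflation V -> inflation W).
Proof.
split=> [lf|[lf Jf]].
  split=> [a u v|g v]; first by rewrite !underlying_scaleE lf.
  by rewrite !inflation_actE -[f]/(linear_of lf : V -> W) linearZZ.
have lfU x q v : f (gaU x q *: v) = gaU x q *: f v.
  have -> : gaU x q = gaU x 1%g * gaU 1 q by rewrite gaUM mulr1 mul1g.
  rewrite -[q]coset_reprK -!scalerA.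
  rewrite -(inflation_actE _ (v : inflation V)).
  rewrite -(inflation_actE _ (f v : inflation W)).
  rewrite -Jf; exact: (linearZZ (linear_of lf)).
have fD (u v : V) : f (u + v) = f u + f v := linearD (linear_of lf) u v.
have f0 : f 0 = 0 := linear0 (linear_of lf).
move=> a u v; rewrite fD; congr (_ + _).
rewrite (gaE a) !scaler_suml (big_morph f fD f0).
by apply: eq_bigr => q _; rewrite lfU.
Qed.

Lemma fixes_inflation (V : lmodType kQ) (v : inflation V) : fixes H v.
Proof.
by move=> g /coset_eq1 Hg; rewrite inflation_actE Hg ga1 scale1r.
Qed.

Lemma projective_inflation (V : lmodType kQ) :
  projective_object (inflation V) -> projective_module V.
Proof.
move=> projV A B e f surj_e.
have he : is_hom (e : inflation A -> inflation B).
  by apply/group_algebra_linearP; exact: linearP.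
have hf : is_hom (f : inflation V -> inflation B).
  by apply/group_algebra_linearP; exact: linearP.
have [|g ge] := projV _ _ (dm_hom_of he) (dm_hom_of hf).
  exact/dm_epi_surj.
have /group_algebra_linearP lg := dm_homP g.
by exists (linear_of lg).
Qed.

End Inflation.

(** * Projectivity and the trace *)

Section HigmanCriterion.
Variables (k : fieldType) (G : topologicalGroupType) (K : openNormal G).
Hypotheses (Gcompact : compact [set: G]) (Knorm : normalizable k K).
Implicit Types M N A B P : discreteModule k G.

Definition identity_is_trace M :=
  exists theta : {linear M -> M}, forall m, trace K theta m = m.

Lemma identity_is_trace_retract M N (f : M -> N) (g : N -> M) :
  is_hom f -> is_hom g -> cancel f g ->
  identity_is_trace N -> identity_is_trace M.
Proof.
move=> hf hg fK [theta thetaE].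
have lin : linear (g \o theta \o f).
  by move=> a u v /=; rewrite hf.1 linearP hg.1.
exists (linear_of lin) => m.
rewrite -[RHS]fK -[f m]thetaE (trace_compl Gcompact) // (trace_compr _ _ _ hf).
by [].
Qed.

(** The trace of a linear lift is an equivariant lift. *)
Lemma identity_is_trace_projective P :
  identity_is_trace P -> projective_object P.
Proof.
move=> [theta thetaE] A B e f /dm_epi_surj surj_e.
have [s es] := linear_regular e.
have lin : linear (s \o f \o theta) by exact: linearP.
exists (dm_hom_of (trace_hom Gcompact Knorm lin)) => x /=.
rewrite (trace_compl Gcompact) //; last exact: dm_homP.
rewrite -[in RHS](thetaE x) (trace_compl Gcompact) //; last exact: dm_homP.
apply: eq_trace => m /=; have [a ea] := surj_e (f (theta m)).
by rewrite -ea es.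
Qed.

(** Higman's condition is self-dual: with a linear retraction [s] of [i], the
    trace of [theta \o s] is an equivariant one. *)
Lemma identity_is_trace_injective M N (i : dm_hom M N) :
  identity_is_trace M -> injective i -> exists r : dm_hom N M, cancel i r.
Proof.
move=> [theta thetaE] i_inj; have [s si] := linear_regular i.
have lin : linear (theta \o s) by exact: linearP.
exists (dm_hom_of (trace_hom Gcompact Knorm lin)) => x /=.
rewrite (trace_compr _ _ _ (dm_homP i)) -[RHS]thetaE.
by apply: eq_trace => m /=; rewrite (i_inj _ _ (si m)).
Qed.

(** The translates of the restriction to the coset [K] are the restrictions to
    all cosets, and these add up to the identity. *)
Lemma coinduced_identity_is_trace N : identity_is_trace (coinduced K Gcompact N).
Proof.
set F := coinduced K Gcompact N.
pose theta (f : F) : F := coinduced_delta Gcompact 1%g (f 1%g).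
have lin : linear theta.
  move=> a u v; apply/funext => q; rewrite /theta /coinduced_delta.
  rewrite [RHS]/GRing.add /= /GRing.scale /=.
  by case: eqP => // _; rewrite scaler0 addr0.
exists (linear_of lin) => f; apply/funext => q.
have lin_ev : linear (fun f : F => f q) by [].
have [W /(_ f (mem_head _ _)) resf] := trace_resolves K Gcompact theta [:: f].
rewrite /trace (integral_linear Gcompact Knorm lin_ev resf).
rewrite -[RHS](integral_const Gcompact Knorm _ q); apply: eq_integral => g.
rewrite -[LHS]/(dm_act g (theta (dm_act g^-1%g f)) q) coinduced_actE.
rewrite /theta /coinduced_delta coinduced_actE.
rewrite -[((coset K g)^-1 * q == 1)%g](inj_eq (mulgI (coset K g))).
rewrite mulVKg mulg1 eq_sym.
case: eqP => [<-|_]; last exact: dm_act0.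
have -> : coset K g^-1%g = (coset K g)^-1%g.
  by apply: (mulgI (coset K g)); rewrite -cosetM !mulgV coset1.
by rewrite invgK mulg1 dm_actKV.
Qed.

Lemma projective_identity_is_trace P : projective_object P -> identity_is_trace P.
Proof.
move=> projP; have hs := @coinduced_sum_hom _ _ K Gcompact P.
have [|s sK] := projP _ _ (dm_hom_of hs) (dm_hom_of (is_hom_id P)).
  apply/dm_epi_surj => n; exists (coinduced_delta Gcompact 1%g n).
  exact: coinduced_sum_delta.
exact: identity_is_trace_retract (dm_homP s) hs sK (coinduced_identity_is_trace P).
Qed.

(** A projective k[G/K]-module is a retract of the coinduced one, because [K]
    acts trivially on the latter, making it a k[G/K]-module too. *)
Lemma projective_module_inflation
    (V : lmodType (group_algebra k (quotient_group K))) :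
  projective_module V -> projective_object (inflation V).
Proof.
move=> projV; apply: identity_is_trace_projective.
set P := inflation V; pose F := coinduced K Gcompact P.
have hs := @coinduced_sum_hom _ _ K Gcompact P.
have fixF (f : F) : fixes K f.
  move=> g Kg; apply/funext => q; rewrite coinduced_actE.
  by have /coset_eq1 -> := Kg; rewrite invg1 mul1g (fixes_inflation _ Kg).
have /group_algebra_linearP lins :
    is_hom (@coinduced_sum _ _ K Gcompact P : inflation (deflation fixF) -> P).
  exact: is_hom_comp hs (deflation_inflation_hom fixF).
have [|s sK] := projV _ _ (linear_of lins) idfun.
  move=> n; exists (coinduced_delta Gcompact 1%g (n : P)).
  exact: (@coinduced_sum_delta _ _ K Gcompact P 1%g n).
have hs' : is_hom (s : inflation V -> inflation (deflation fixF)).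
  by apply/group_algebra_linearP; exact: linearP.
exact: identity_is_trace_retract
  (is_hom_comp (deflation_inflation_hom fixF) hs') hs sK
  (coinduced_identity_is_trace P).
Qed.

End HigmanCriterion.

(** * Direct sums *)

Section DirectSumTheory.
Variables (k : fieldType) (G : topologicalGroupType).
Variables (I : choiceType) (M : I -> discreteModule k G).
Local Notation S := (direct_sum M).

Definition ds_supp (f : S) : {fset I} := fset_set [set i | ds_val f i != 0].

Lemma mem_ds_supp (f : S) i : (i \in ds_supp f) = (ds_val f i != 0).
Proof.
rewrite in_fset_set; last exact: ds_finite.
by apply/idP/idP; rewrite inE.
Qed.

Lemma ds_val_hom i : is_hom (fun f : S => ds_val f i).
Proof. by []. Qed.

Lemma ds_val_sum (J : Type) (s : seq J) (F : J -> S) i :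
  ds_val (\sum_(j <- s) F j) i = \sum_(j <- s) ds_val (F j) i.
Proof. exact: (linear_sum (linear_of (ds_val_hom i).1)). Qed.

Section Injection.
Variable i : I.

Let fin_inj (m : M i) :
  finite_set [set j | dfwith (fun j => 0 : M j) i m j != 0].
Proof.
apply: sub_finite_set (finite_set1 i) => j /=.
by apply: contraNeq; rewrite eq_sym => ij; rewrite dfwithout.
Qed.

Definition ds_inj (m : M i) : S := ds_mk (fin_inj m).

Lemma ds_val_inj m : ds_val (ds_inj m) i = m.
Proof. exact: dfwithin. Qed.

Lemma ds_val_inj_neq m j : j != i -> ds_val (ds_inj m) j = 0.
Proof. by move=> ji; rewrite [LHS]dfwithout // eq_sym. Qed.

Lemma ds_inj_hom : is_hom ds_inj.
Proof.
split=> [a u v|g m]; apply: ds_eqP => j.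
  have [->|ji] := eqVneq j i; first by rewrite ds_valD ds_valZ !ds_val_inj.
  by rewrite ds_valD ds_valZ !ds_val_inj_neq // scaler0 addr0.
rewrite ds_val_act; have [->|ji] := eqVneq j i; first by rewrite !ds_val_inj.
by rewrite !ds_val_inj_neq // dm_act0.
Qed.

End Injection.

Lemma ds_inj_sum (f : S) : f = \sum_(i <- ds_supp f) ds_inj (ds_val f i).
Proof.
apply: ds_eqP => i; rewrite ds_val_sum.
have [fi0|fi0] := eqVneq (ds_val f i) 0.
  rewrite fi0 big1_seq // => j /andP[_]; rewrite mem_ds_supp => fj0.
  have [ij|ij] := eqVneq i j; first by rewrite -ij fi0 eqxx in fj0.
  by rewrite ds_val_inj_neq.
rewrite (big_rem i) ?mem_ds_supp //= ds_val_inj big1_seq ?addr0 // => j.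
rewrite mem_rem_uniq ?fset_uniq // !inE eq_sym => /andP[_ /andP[ij _]].
by rewrite ds_val_inj_neq.
Qed.

Section Copairing.
Variables (N : discreteModule k G) (phi : forall i, dm_hom (M i) N).

Definition copair (f : S) : N := \sum_(i <- ds_supp f) phi i (ds_val f i).

Lemma copairw (d : {fset I}) f : (ds_supp f `<=` d)%fset ->
  copair f = \sum_(i <- d) phi i (ds_val f i).
Proof.
move=> fd; rewrite /copair (big_fset_incl _ fd) // => i _.
by rewrite mem_ds_supp negbK => /eqP ->; rewrite linear0.
Qed.

Lemma copair_hom : is_hom copair.
Proof.
split=> [a u v|g f].
  have sub : (ds_supp (a *: u + v) `<=` ds_supp u `|` ds_supp v)%fset.
    apply/fsubsetP => i; rewrite in_fsetU !mem_ds_supp ds_valD ds_valZ -negb_and.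
    by apply: contraNN => /andP[/eqP-> /eqP->]; rewrite scaler0 addr0.
  rewrite (copairw sub) (copairw (fsubsetUl _ (ds_supp v))).
  rewrite (copairw (fsubsetUr (ds_supp u) _)) scaler_sumr -big_split.
  by apply: eq_bigr => i _; rewrite ds_valD ds_valZ linearP.
have sub : (ds_supp (dm_act g f) `<=` ds_supp f)%fset.
  apply/fsubsetP => i; rewrite !mem_ds_supp ds_val_act.
  by apply: contraNN => /eqP ->; rewrite dm_act0.
rewrite (copairw sub) /copair dm_act_sum; apply: eq_bigr => i _.
by rewrite ds_val_act dm_funJ.
Qed.

Lemma copair_inj i m : copair (ds_inj m) = phi i m.
Proof.
have sub : (ds_supp (ds_inj m) `<=` [fset i])%fset.
  apply/fsubsetP => j; rewrite mem_ds_supp in_fset1.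
  by apply: contraNT => ji; rewrite ds_val_inj_neq.
by rewrite (copairw sub) big_seq_fset1 ds_val_inj.
Qed.

End Copairing.

Lemma direct_sum_projective :
  (forall i, projective_object (M i)) -> projective_object S.
Proof.
move=> projM A B e f epi_e.
have lift i : exists g : dm_hom (M i) A, forall m, e (g m) = f (ds_inj m).
  have hf := is_hom_comp (dm_homP f) (ds_inj_hom i).
  exact: (projM i _ _ e (dm_hom_of hf) epi_e).
pose g i := sval (cid (lift i)).
have gE i m : e (g i m) = f (ds_inj m) := svalP (cid (lift i)) m.
exists (dm_hom_of (copair_hom g)) => x /=.
rewrite [in RHS](ds_inj_sum x) !linear_sum.
by apply: eq_bigr => i _; rewrite gE.
Qed.

(** The trace is computed componentwise, the projections being homomorphisms.
    Hence infinite direct sums of such modules still split off wherever they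
    embed. *)
Lemma direct_sum_identity_is_trace (K : openNormal G) :
  compact [set: G] -> normalizable k K ->
  (forall i, identity_is_trace K (M i)) -> identity_is_trace K S.
Proof.
move=> Gcompact Knorm trM.
pose theta i := sval (cid (trM i)).
have thetaE i m : trace K (theta i) m = m := svalP (cid (trM i)) m.
have fin (f : S) : finite_set [set i | theta i (ds_val f i) != 0].
  apply: sub_finite_set (ds_finite f) => i /=.
  by apply: contraNneq => ->; rewrite linear0.
pose Theta (f : S) : S := ds_mk (fin f).
have lin : linear Theta.
  by move=> a u v; apply: ds_eqP => i; exact: (linearP (theta i)).
exists (linear_of lin) => f; apply: ds_eqP => i.
rewrite -[RHS]thetaE (trace_compr _ _ _ (ds_val_hom i)).
exact: (trace_compl Gcompact Knorm _ _ (ds_val_hom i)).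
Qed.

End DirectSumTheory.

(** * Existence of an open normal subgroup of order prime to p *)

Section Existence.
Variables (k : fieldType) (p : nat) (G : topologicalGroupType).
Hypotheses (charkp : has_characteristic k p) (Gcompact : compact [set: G]).
Implicit Types (U W : openNormal G) (M N P : discreteModule k G).

Section Invariants.
Variables (M : discreteModule k G) (U : openNormal G).

Lemma invariants_subspace : is_subspace [set m : M | fixes U m].
Proof.
split=> [g Ug|a u v fu fv g Ug]; first exact: dm_act0.
by rewrite dm_act_linear fu // fv.
Qed.

Lemma invariants_stable g (m : M) : fixes U m -> fixes U (dm_act g m).
Proof. exact: fixes_act. Qed.

Definition invariants : discreteModule k G :=
  submodule invariants_subspace invariants_stable.

Lemma fixes_invariants (m : invariants) : fixes U m.
Proof.
by move=> g Ug; apply: subspace_val_inj; exact: (subspace_valP m).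
Qed.

End Invariants.

(** [P] is covered by the direct sum of its submodules of [U]-invariants, so it
    embeds in that sum and some component of the image of [x] is nonzero. *)
Lemma projective_hom_open_kernel P (x : P) : projective_object P -> x != 0 ->
  exists U N (rho : dm_hom P N), (forall n : N, fixes U n) /\ rho x != 0.
Proof.
move=> projP x0.
pose U (y : P) := sval (cid (fixes_exists Gcompact y)).
have fU y : fixes (U y) y := svalP (cid (fixes_exists Gcompact y)).
pose Q y := invariants P (U y).
pose phi y : dm_hom (Q y) P := dm_hom_of
  (submodule_val_hom (invariants_subspace P (U y))
     (@invariants_stable P (U y))).
have hc := copair_hom phi.
have [|s sK] := projP _ _ (dm_hom_of hc) (dm_hom_of (is_hom_id P)).
  apply/dm_epi_surj => y.
  exists (ds_inj (subspace_sub (invariants_subspace P (U y)) (fU y) : Q y)).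
  exact: copair_inj.
have [y sy] : exists y, ds_val (s x) y != 0.
  apply: contrapT => ns; case/eqP: x0; have /= <- := sK x.
  rewrite /copair big1 // => y _; have [->|sy] := eqVneq (ds_val (s x) y) 0.
    by rewrite linear0.
  by case: ns; exists y.
exists (U y), (Q y), (dm_hom_of (is_hom_comp (ds_val_hom Q y) (dm_homP s))).
by split=> //; exact: fixes_invariants.
Qed.

(** If [p] divides the index of [W] in [U], the sum over the cosets of [W] of a
    function invariant under [U] is that index, which is 0 in [k], times a sum
    over the cosets of [U]. The lift of [rho] sends [x] to such a function. *)
Lemma projective_prime_to P (x : P) : projective_object P -> x != 0 ->
  exists K : openNormal G, order_prime_to p (subgroup K).
Proof.
move=> projP x0.
have [V [N [rho [fN rhox]]]] := projective_hom_open_kernel projP x0.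
have [Ux fx] := fixes_exists Gcompact x.
pose U := openNormalI V Ux; exists U.
apply: contrapT => /(subindex_eq0 charkp Gcompact).
have {}fN (n : N) : fixes U n by apply: fixes_sub (fN n) => g /openNormalIE[].
have {}fx : fixes U x by apply: fixes_sub fx => g /openNormalIE[].
case=> W WU idx0; case/eqP: rhox.
have hs := @coinduced_sum_hom _ _ W Gcompact N.
have [|t tK] := projP _ _ (dm_hom_of hs) rho.
  apply/dm_epi_surj => n; exists (coinduced_delta Gcompact 1%g n).
  exact: coinduced_sum_delta.
rewrite -tK /= /coinduced_sum (@coset_sum_refine _ W _ _ U) //.
- by rewrite -scaler_nat idx0 scale0r.
- exact: quotient_finite.
- exact: quotient_finite.
move=> g u Uu; have Uh : openNormal_set U (u ^ g^-1)%g by exact: openNormalJ.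
rewrite -[in RHS](fx _ (openNormalV Uh)) dm_funJ coinduced_actE fN; last first.
  exact: openNormalV.
congr (t x _); apply: (mulgI (coset W (u ^ g^-1)^-1)%g).
have -> : (g * u = u ^ g^-1 * g)%g by rewrite conjgE invgK mulgA mulgVK.
by rewrite mulVKg -cosetM mulKg.
Qed.

End Existence.

(** * Idempotents of finite rank *)

Section FiniteRank.
Variables (k : fieldType) (V : lmodType k).

Definition combination n (v : 'I_n -> V) (c : 'rV[k]_n) : V :=
  \sum_(i < n) c 0 i *: v i.

Lemma combination_linear n (v : 'I_n -> V) : linear (combination v).
Proof.
move=> a c d; rewrite /combination scaler_sumr -big_split.
by apply: eq_bigr => i _; rewrite !mxE scalerDl scalerA.
Qed.

Definition span n (v : 'I_n -> V) : set V := range (combination v).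

Lemma span_subspace n (v : 'I_n -> V) : is_subspace (span v).
Proof. exact: (linear_range (linear_of (combination_linear v))). Qed.

Lemma span_mem n (v : 'I_n -> V) i : span v (v i).
Proof.
exists (delta_mx 0 i) => //; rewrite /combination (bigD1 i) //= mxE !eqxx scale1r.
by rewrite big1 ?addr0 // => j ji; rewrite mxE (negPf ji) andbF scale0r.
Qed.

Lemma span_nth (s : seq V) y : y \in s -> span (fun i : 'I_(size s) => s`_i) y.
Proof.
move=> ys; have iy : (index y s < size s)%N by rewrite index_mem.
by rewrite -[y](nth_index 0 ys); exact: (span_mem _ (Ordinal iy)).
Qed.

Lemma subspace_sum (S : set V) (J : Type) (s : seq J) (F : J -> V) :
  is_subspace S -> (forall j, S (F j)) -> S (\sum_(j <- s) F j).
Proof.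
by move=> subS SF; apply: big_ind => // [|u v]; [exact: subS.1|exact: subspaceD].
Qed.

Lemma span_sub n (v : 'I_n -> V) (S : set V) :
  is_subspace S -> (forall i, S (v i)) -> span v `<=` S.
Proof.
move=> subS Sv _ [c _ <-]; apply: subspace_sum => // i; exact: subspaceZ.
Qed.

End FiniteRank.

Section Fitting.
Variables (k : fieldType) (G : topologicalGroupType) (P : discreteModule k G).
Implicit Types (e d : P -> P).

(** Fitting's lemma: [psi] is annihilated by a polynomial 'X^(m.+1) * h with
    h(0) != 0, and Bezout's identity u * 'X^(m.+1) + w * h = 1 makes
    (u * 'X^(m.+1))(psi) an idempotent. It fixes [x]: the eigenvalue 1 of [psi]
    is a root of h, so that u * 'X^(m.+1) has the value 1 there. *)
Lemma fitting_idempotent n (v : 'I_n -> P) (psi : P -> P) (x : P) :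
  is_hom psi -> (forall y, span v (psi y)) -> psi x = x -> x != 0 ->
  exists e, [/\ is_hom e, forall y, e (e y) = e y, e x = x &
    forall y, span v (e y)].
Proof.
case: n v => [|n] v hpsi vpsi psix x0.
  by case/eqP: x0; rewrite -psix; have [c _ <-] := vpsi x; exact: big_ord0.
pose L := linear_of (combination_linear v).
have [s LsL] := linear_regular L.
pose C y := s (psi y).
have LC y : L (C y) = psi y by rewrite /C; have [c _ <-] := vpsi y; exact: LsL.
have C_lin : linear C by move=> a y z; rewrite /C hpsi.1 linearP.
have CL_lin : linear (C \o L).
  by move=> a y z; rewrite -[LHS]/(C (L _)) linearP C_lin.
pose A := lin1_mx (linear_of CL_lin).
have CLE c : C (L c) = c *m A by rewrite mul_rV_lin1.
(* For a polynomial q, [E (horner_mx A q)] is ('X * q)(psi). *)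
pose E (B : 'M[k]_n.+1) y := L (C y *m B).
have E_lin B : linear (E B).
  by move=> a y z; rewrite /E C_lin mulmxDl -scalemxAl linearP.
have hornerX q c : horner_mx A (q * 'X + c%:P) = horner_mx A q *m A + c%:M.
  by rewrite rmorphD rmorphM /= horner_mx_X horner_mx_C.
have hE q : is_hom (E (horner_mx A q)).
  split=> //; elim/poly_ind: q => [|q c IH] g y.
    by rewrite /E rmorph0 !mulmx0 !linear0 dm_act0.
  have EX z : E (horner_mx A (q * 'X + c%:P)) z =
      psi (E (horner_mx A q) z) + c *: psi z.
    rewrite /E hornerX mulmxDr mulmxA.
    by rewrite -CLE linearD LC mul_mx_scalar linearZZ LC.
  by rewrite !EX IH !hpsi.2 dm_actD dm_actZ.
pose f := char_poly A.
have f0 : horner_mx A f = 0 := Cayley_Hamilton A.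
have [m [h hroot fE]] := multiplicity_XsubC f 0.
have h0 : ~~ root h 0 by move: hroot; rewrite monic_neq0 // char_poly_monic.
have {}fE : f = h * 'X^m by rewrite fE subr0.
have /Bezout_eq1_coprimepP[[u w] /= uw] : coprimep 'X^(m.+1) h.
  by rewrite coprimep_sym coprimep_expr // coprimepX.
have [b bE] : exists b, b = u * 'X^m by exists (u * 'X^m).
pose B := horner_mx A b.
have BAB : B *m A *m B = B.
  have -> : B *m A *m B = horner_mx A (b * 'X * b).
    by rewrite !rmorphM /= horner_mx_X.
  have -> : b * 'X * b = b - u * w * f.
    rewrite bE fE -[X in X - _]mulr1 -uw exprS; ring.
  by rewrite rmorphB rmorphM /= f0 mulr0 subr0.
have Cx : C x *m A = C x by rewrite -CLE LC psix.
have Cq q : C x *m horner_mx A q = q.[1] *: C x.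
  elim/poly_ind: q => [|q c IH]; first by rewrite rmorph0 mulmx0 horner0 scale0r.
  rewrite hornerX mulmxDr mulmxA IH -scalemxAl Cx mul_mx_scalar -scalerDl.
  by rewrite hornerMXaddC mulr1.
have Cx0 : C x != 0.
  by apply: contra_neq x0 => Cx0; rewrite -psix -LC Cx0 linear0.
have u1 : u.[1] = 1.
  have : f.[1] *: C x = 0 by rewrite -Cq f0 mulmx0.
  move/eqP; rewrite scaler_eq0 (negPf Cx0) orbF fE hornerM hornerXn expr1n mulr1.
  move=> /eqP h1; have := congr1 (fun q => q.[1]) uw.
  by rewrite hornerD !hornerM hornerXn expr1n h1 mulr0 addr0 mulr1 hornerC.
exists (E B); split=> [|y||y]; [exact: hE| | |by exists (C y *m B)].
  by rewrite {1}/E CLE -!mulmxA [B *m _]mulmxA BAB.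
by rewrite /E Cq bE hornerM hornerXn expr1n u1 mulr1 scale1r LC psix.
Qed.

End Fitting.

Section Primitive.
Variables (k : fieldType) (G : topologicalGroupType) (P : discreteModule k G).
Implicit Types (d e : P -> P).

Definition idempotent_hom e := is_hom e /\ forall x, e (e x) = e x.

Definition rank_le n e := exists v : 'I_n -> P, forall x, span v (e x).

(** Among idempotents, [e * e1 = e1 * e = e1] says that the image of [e1] is a
    direct summand of the image of [e]. *)
Definition primitive e := forall e1, idempotent_hom e1 ->
  (forall x, e (e1 x) = e1 x) -> (forall x, e1 (e x) = e1 x) ->
  (forall x, e1 x = 0) \/ (forall x, e1 x = e x).

(** A nonzero combination [z] of the spanning family of [e] that is killed by
    [e1] makes the image under [e1] of one of its members redundant. *)
Lemma rank_le_proper n e e1 : idempotent_hom e -> idempotent_hom e1 ->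
  (forall x, e (e1 x) = e1 x) -> (forall x, e1 (e x) = e1 x) ->
  rank_le n.+1 e -> (exists x, e1 x != e x) -> rank_le n e1.
Proof.
move=> [he ee] [he1 ee1] ee1E e1eE [v ev] [x e1x].
pose z := e x - e1 x.
have eB y1 y2 : e (y1 - y2) = e y1 - e y2 := linearB (linear_of he.1) y1 y2.
have e1B y1 y2 : e1 (y1 - y2) = e1 y1 - e1 y2 := linearB (linear_of he1.1) y1 y2.
have ez : e z = z by rewrite /z eB ee ee1E.
have e1z : e1 z = 0 by rewrite /z e1B e1eE ee1 subrr.
have z0 : z != 0 by rewrite subr_eq0 eq_sym.
have [c _ cE] : span v z by rewrite -ez.
have [j cj] : exists j, c 0 j != 0.
  apply: contrapT => nc; case/eqP: z0; rewrite -cE /combination big1 // => i _.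
  have [->|ci] := eqVneq (c 0 i) 0; first by rewrite scale0r.
  by case: nc; exists i.
have e1comb c' : e1 (combination v c') = combination (e1 \o v) c'.
  rewrite -[e1]/(linear_of he1.1 : P -> P) linear_sum.
  by apply: eq_bigr => i _; rewrite linearZZ.
pose v' i := e1 (v (lift j i)).
have e1v i : span v' (e1 (v i)).
  have [ij|[i' ->]] : i = j \/ exists i', i = lift j i'.
    by case: (unliftP j i) => [i' ->|->]; [right; exists i'|left].
    rewrite {}ij; have rel : c 0 j *: e1 (v j) =
        - \sum_(i' < n) c 0 (lift j i') *: v' i'.
      apply/eqP; rewrite -addr_eq0; apply/eqP.
      by rewrite -[RHS]e1z -cE e1comb /combination (bigD1_ord j).
    rewrite -[e1 _]scale1r -(mulVf cj) -scalerA rel.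
    apply: subspaceZ; first exact: span_subspace.
    apply: subspaceN; first exact: span_subspace.
    apply: subspace_sum => [|i']; first exact: span_subspace.
    apply: subspaceZ; first exact: span_subspace.
    exact: span_mem.
  exact: span_mem.
exists v' => y; rewrite -e1eE; have [c' _ <-] := ev y.
by rewrite e1comb; apply: (span_sub (span_subspace v') e1v); exists c'.
Qed.

Lemma rank_le_fixes (K : openNormal G) n e : compact [set: G] ->
  idempotent_hom e -> rank_le n e ->
  exists2 H : openNormal G, H `<=` K & forall x, e x = x -> fixes H x.
Proof.
move=> Gcompact [he ee] [v ev].
have [H HK fH] := fixes_seq_exists Gcompact K [seq v i | i <- enum 'I_n].
exists H => // x <-; apply: (span_sub (invariants_subspace P H)) (ev x) => i.
by apply: fH; apply: map_f; rewrite mem_enum.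
Qed.

Variable K : openNormal G.
Hypotheses (Gcompact : compact [set: G]) (Knorm : normalizable k K).
Hypothesis trP : identity_is_trace K P.

(** If the identity is the trace of [theta], then the trace of [theta \o lambda]
    fixes every vector whose orbit is fixed by [lambda]; and it has finite rank
    when [lambda] does, because all orbits are finite. *)
Lemma finite_rank_hom (x : P) : exists psi n,
  [/\ is_hom psi, rank_le n psi & psi x = x].
Proof.
have [theta thetaE] := trP.
have [U fUx] := fixes_exists Gcompact x.
pose s := [seq dm_act (coset_repr q) x | q <- fset_set [set: quotient_group U]].
pose v := fun i : 'I_(size s) => s`_i.
pose L := linear_of (combination_linear v).
have [t LtL] := linear_regular L.
pose lambda y := L (t y).
have lambda_orbit g : lambda (dm_act g x) = dm_act g x.
  have [c _ <-] : span v (dm_act g x); last exact: LtL.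
  apply: span_nth; apply/mapP; exists (coset U g).
    by rewrite mem_cosets //; exact: quotient_finite.
  by apply: (right_invariant_coset (fixes_right_invariant fUx)); rewrite coset_reprK.
have lin : linear (theta \o lambda).
  by move=> a y z; rewrite /= /lambda (linearP t) (linearP L) linearP.
have [W _ fW] := fixes_seq_exists Gcompact K [seq theta y | y <- s].
pose r := [seq dm_act (coset_repr q) (theta y) | y <- s,
             q <- fset_set [set: quotient_group W]].
pose w := fun i : 'I_(size r) => r`_i.
have subw := span_subspace w.
exists (trace K (theta \o lambda)), (size r); split.
- exact: trace_hom.
- exists w => y.
  have [X resX] := trace_resolves K Gcompact (theta \o lambda) [:: y].
  have {}resX := resX y (mem_head _ _).
  rewrite /trace (integralE Gcompact Knorm resX) /average.
  apply: (subspaceZ subw); apply: (subspace_sum _ subw) => q.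
  set g := coset_repr q; set z := dm_act _ y; rewrite /= /lambda /=.
  rewrite /combination linear_sum dm_act_sum; apply: (subspace_sum _ subw) => i.
  rewrite linearZZ dm_actZ; apply: (subspaceZ subw); apply: span_nth.
  have vs : v i \in s by apply: mem_nth.
  apply/allpairsPdep; exists (v i), (coset W g); split=> //.
    by rewrite mem_cosets //; exact: quotient_finite.
  apply: (@right_invariant_coset _ _ W (fun h => dm_act h (theta (v i))));
    last by rewrite coset_reprK.
  by apply: fixes_right_invariant; apply: fW; exact: map_f.
rewrite -[RHS]thetaE; apply: eq_integral => g /=.
by rewrite lambda_orbit.
Qed.

(** A nonzero idempotent of minimal rank, among those with image in the image of
    [d], is primitive: proper summands have smaller rank. *)
Lemma primitive_idempotent_exists d (x : P) :
  idempotent_hom d -> d x = x -> x != 0 ->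
  exists e n, [/\ idempotent_hom e, rank_le n e, primitive e,
    exists y, e y != 0 & forall y, d (e y) = e y].
Proof.
move=> [hd dd] dx x0.
pose Q n := exists e, [/\ idempotent_hom e, rank_le n e,
  exists y, e y != 0 & forall y, d (e y) = e y].
have Q_ex : exists n, `[< Q n >].
  have [psi [n [hpsi [v vpsi] psix]]] := finite_rank_hom x.
  have [||||e [he ee ex ve]] := @fitting_idempotent _ _ P n (d \o v) (d \o psi) x.
  - exact: is_hom_comp.
  - move=> y; rewrite [(_ \o _) y]/=; have [c _ <-] := vpsi y; exists c => //.
    rewrite -[d]/(linear_of hd.1 : P -> P) linear_sum.
    by apply: eq_bigr => i _; rewrite linearZZ.
  - by rewrite /= psix.
  - exact: x0.
  exists n; apply/asboolP; exists e; split=> //; first by exists (d \o v).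
    by exists x; rewrite ex.
  move=> y; have [c _ <-] := ve y.
  rewrite -[d]/(linear_of hd.1 : P -> P) linear_sum.
  by apply: eq_bigr => i _; rewrite linearZZ /= dd.
case: (ex_minnP Q_ex) => n /asboolP[e [ie re e0 de]] n_min.
exists e, n; split=> // e1 ie1 ee1 e1e.
have [e1_0|e1_n0] := pselect (forall y, e1 y = 0); [by left|right].
apply: contrapT => e1_ne; case: n re n_min => [|n] re n_min.
  have [y] := e0; have [v /(_ y) [c _ <-]] := re.
  by rewrite /combination big_ord0 eqxx.
have /n_min : `[< Q n >].
  apply/asboolP; exists e1; split=> //.
  - apply: (rank_le_proper ie ie1 ee1 e1e re).
    apply: contrapT => ne; apply: e1_ne => y; apply/eqP; apply: contrapT => nz.
    by apply: ne; exists y; apply/negP.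
  - apply: contrapT => ne; apply: e1_n0 => y; apply/eqP; apply: contrapT => nz.
    by apply: ne; exists y; apply/negP.
  - by move=> y; rewrite -ee1 de.
by rewrite ltnn.
Qed.

End Primitive.

(** * Decomposition into indecomposables *)

Section ModuleDecomposition.
Variables (R : nzRingType) (V : lmodType R) (A B : {pred V}).
Hypotheses (subA : submod_closed A) (subB : submod_closed B).
Hypotheses (sumAB : forall v, exists a b, [/\ a \in A, b \in B & v = a + b]).
Hypothesis capAB : forall v, v \in A -> v \in B -> v = 0.

Lemma direct_projection : exists2 pi : {linear V -> V},
  forall v, pi v \in A & forall a b, a \in A -> b \in B -> pi (a + b) = a.
Proof.
have closedD (C : {pred V}) : submod_closed C ->
    forall c u v, u \in C -> v \in C -> c *: u + v \in C.
  by move=> [_ subC] c u v; exact: subC.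
have uniq a b a' b' : a \in A -> b \in B -> a' \in A -> b' \in B ->
    a + b = a' + b' -> a = a'.
  move=> Aa Bb Aa' Bb' ab; apply/subr0_eq; apply: capAB.
    by rewrite -scaleN1r addrC; exact: closedD.
  have -> : a - a' = b' - b.
    by apply/eqP; rewrite subr_eq addrAC eq_sym subr_eq ab addrC.
  by rewrite -scaleN1r addrC; exact: closedD.
have ex v : exists a, a \in A /\ exists2 b, b \in B & v = a + b.
  by have [a [b [Aa Bb ->]]] := sumAB v; exists a; split=> //; exists b.
pose pi v := sval (cid (ex v)).
have piP v : pi v \in A /\ exists2 b, b \in B & v = pi v + b := svalP (cid (ex v)).
have piE a b : a \in A -> b \in B -> pi (a + b) = a.
  move=> Aa Bb; have [Api [b' Bb' abE]] := piP (a + b).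
  exact: (uniq _ _ _ _ Api Bb' Aa Bb (esym abE)).
have pi_lin : linear pi.
  move=> c u v; have [Au [b Bb uE]] := piP u; have [Av [b' Bb' vE]] := piP v.
  rewrite [in LHS]uE [in LHS]vE scalerDr addrACA.
  by apply: piE; exact: closedD.
by exists (linear_of pi_lin) => [v|]; [exact: (piP v).1|exact: piE].
Qed.

End ModuleDecomposition.

Section Decomposition.
Variables (k : fieldType) (p : nat) (G : topologicalGroupType) (K : openNormal G).
Hypotheses (charkp : has_characteristic k p) (Gcompact : compact [set: G]).
Hypothesis Knorm : normalizable k K.

Lemma normalizable_order_prime_to (H : openNormal G) :
  H `<=` K -> order_prime_to p (subgroup H).
Proof.
move=> HK; apply: contrapT => /(subindex_eq0 charkp Gcompact)[W WH idx0].
have WK : W `<=` K := subset_trans WH HK.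
have := Knorm WK; rewrite (subindexM Gcompact WH HK) natrM idx0 mulr0 eqxx.
by [].
Qed.

Variable P : discreteModule k G.
Hypothesis trP : identity_is_trace K P.

(** A decomposition of [V] into [A] and [B], with projection [pi] onto [A],
    gives the idempotent [phi \o pi \o rho] below [phi \o rho]. *)
Lemma primitive_indecomposable (H : openNormal G)
  (V : lmodType (group_algebra k (quotient_group H)))
  (phi : inflation V -> P) (rho : P -> inflation V) :
  is_hom phi -> is_hom rho -> cancel phi rho -> (exists v : V, v != 0) ->
  primitive (phi \o rho) -> indecomposable_module V.
Proof.
move=> hphi hrho phiK V0 prim; split=> // A B subA subB sumAB capAB.
have [pi Api piE] := direct_projection subA subB sumAB capAB.
have hpi : is_hom (pi : inflation V -> inflation V).
  by apply/group_algebra_linearP; exact: linearP.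
have piA v : v \in A -> pi v = v.
  by move=> Av; rewrite -[v in LHS]addr0 piE //; exact: subB.1.
have piB v : v \in B -> pi v = 0.
  by move=> Bv; rewrite -[v]add0r piE //; exact: subA.1.
have phi_inj v : phi v = 0 -> v = 0.
  move=> phiv; rewrite -[v]phiK phiv; exact: (linear0 (linear_of hrho.1)).
have [|||e10|e1e] := prim (phi \o (pi \o rho)).
- split=> [|x]; first by apply: is_hom_comp => //; exact: is_hom_comp.
  by rewrite /= phiK piA.
- by move=> x; rewrite /= phiK.
- by move=> x; rewrite /= phiK.
- left=> v Av; apply: phi_inj.
  by have := e10 (phi v); rewrite /= phiK piA.
right=> v Bv; apply: phi_inj.
have := e1e (phi v); rewrite /= phiK piB // => <-.
exact: (linear0 (linear_of hphi.1)).
Qed.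

Definition component (e : P -> P) :=
  [/\ idempotent_hom e, exists n, rank_le n e, primitive e & exists y, e y != 0].

Record summand (e : P -> P) := Summand {
  summand_group : openNormal G;
  summand_module : lmodType (group_algebra k (quotient_group summand_group));
  summand_val : dm_hom (inflation summand_module) P;
  summand_spec :
    [/\ order_prime_to p (subgroup summand_group),
        finite_dimensional (underlying summand_module),
        indecomposable_module summand_module & projective_module summand_module];
  summand_trace : identity_is_trace K (inflation summand_module);
  summand_inj : injective summand_val;
  summand_image : forall v, e (summand_val v) = summand_val v;
  summand_surj : forall y, e y = y -> exists v, summand_val v = y
}.

Lemma component_summand (e : P -> P) : component e -> summand e.
Proof.
move=> ce; suff /inhabited_witness : inhabited (summand e) by [].
move: ce => [[he ee] [n re] prim [y0 ey0]].
have [H HK fH] := rank_le_fixes K Gcompact (conj he ee) re.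
have subN : is_subspace [set x | e x = x].
  split=> [|a u v /= eu ev]; first exact: (linear0 (linear_of he.1)).
  by rewrite /= he.1 eu ev.
have stableN g m : [set x | e x = x] m -> [set x | e x = x] (dm_act g m).
  by rewrite /= he.2 => ->.
pose N := submodule subN stableN.
have fixN (m : N) : fixes H m.
  by move=> g Hg; apply: subspace_val_inj; exact: (fH _ (subspace_valP m)).
pose V := deflation fixN.
pose phi : inflation V -> P := fun v => subspace_val (v : N).
pose rho : P -> inflation V := fun y => (subspace_sub subN (ee y) : N).
have hphi : is_hom phi.
  exact: is_hom_comp (submodule_val_hom subN stableN)
    (deflation_inflation_hom fixN).
have hrho : is_hom rho.
  exact: is_hom_comp (inflation_deflation_hom fixN)
    (submodule_sub_hom subN stableN ee he).
have phiK : cancel phi rho.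
  by move=> v; apply: subspace_val_inj; exact: (subspace_valP (v : N)).
have trV : identity_is_trace K (inflation V).
  exact: (identity_is_trace_retract Gcompact Knorm hphi hrho phiK trP).
apply: inhabits; apply: (@Summand _ H V (dm_hom_of hphi)) => //.
- split.
  + exact: normalizable_order_prime_to.
  + have [v ve] := re; exists n, (rho \o v) => w.
    have [c _ cE] := ve (phi w); exists (c 0).
    have -> : w = rho (e (phi w)).
      by rewrite -[LHS]phiK; congr rho; rewrite (subspace_valP (w : N)).
    rewrite -cE -[rho]/(linear_of hrho.1 : P -> inflation V) linear_sum.
    by apply: eq_bigr => i _; rewrite linearZZ.
  + apply: (primitive_indecomposable hphi hrho phiK); last exact: prim.
    exists (rho y0); apply: contra_neq ey0 => r0.
    rewrite -[LHS]/(phi (rho y0)) r0; exact: (linear0 (linear_of hphi.1)).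
  + apply: projective_inflation; exact: (identity_is_trace_projective Gcompact Knorm).
- by move=> v; exact: (subspace_valP (v : N)).
- by move=> y ey; exists (rho y).
Qed.

Local Notation J := {classic (P -> P)}.

(** Independence of the images: the sum of the subspaces [range e], for [e] in
    [F], is direct. *)
Definition independent (F : set J) := forall (s : seq J) (x : J -> P), uniq s ->
  {in s, forall e, F e} -> {in s, forall e : J, (e : P -> P) (x e) = x e} ->
  \sum_(e <- s) x e = 0 -> {in s, forall e, x e = 0}.

(** Independence only involves finitely many members at a time, so it passes to
    unions of chains. *)
Lemma maximal_independent : exists F : set J,
  [/\ forall e : J, F e -> component e, independent F &
    forall e : J, component e -> independent (e |` F) -> F e].
Proof.
pose Q (F : set J) := (forall e : J, F e -> component e) /\ independent F.
have [C CQ totC|F [[Fc Fi] Fmax]] := @Zorn_bigcup J Q.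
  split=> [e [F /CQ[Fc _]]|s x us sC xs sum0]; first exact: Fc.
  have [->//|sN0] := eqVneq s [::].
  have [F CF sF] : exists2 F, C F & {in s, forall e, F e}.
    elim: s sN0 sC {us xs sum0} => // e s IH _ sC.
    have [A CA Ae] := sC e (mem_head _ _).
    have [s0|sN0] := eqVneq s [::].
      by exists A => // e'; rewrite s0 inE => /eqP ->.
    have [|B CB Bs] := IH sN0.
      by move=> e' e's; apply: sC; rewrite inE e's orbT.
    have [AB|BA] := totC A B CA CB.
      by exists B => // e'; rewrite inE => /orP[/eqP->|/Bs//]; exact: AB.
    by exists A => // e'; rewrite inE => /orP[/eqP->//|/Bs]; exact: BA.
  exact: (CQ F CF).2 us sF xs sum0.
exists F; split=> // e ce ie; apply: contrapT => nFe.
apply: (Fmax (e |` F)); last by split=> // e' [->|/Fc].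
by split=> [e' Fe'|sub]; [right|apply: nFe; apply: sub; left].
Qed.

(** The direct sum of a maximal family splits off by injectivity. If the
    projection [d] onto the complement is nonzero, a primitive idempotent [e]
    with [d \o e = e] is independent of the family, which [d] kills. *)
Lemma decomposition : exists (I : choiceType) (H : I -> openNormal G)
    (V : forall i, lmodType (group_algebra k (quotient_group (H i)))),
  (forall i, [/\ order_prime_to p (subgroup (H i)),
                 finite_dimensional (underlying (V i)),
                 indecomposable_module (V i) & projective_module (V i)]) /\
  dm_isomorphic P (direct_sum (fun i => inflation (V i))).
Proof.
have [F [Fc Fi Fmax]] := maximal_independent.
pose I : choiceType := set_type F.
have cI (i : I) : component (val i) by apply: Fc; exact: set_valP.
pose D i := component_summand (cI i).
pose H i := summand_group (D i).
pose V i : lmodType (group_algebra k (quotient_group (H i))) :=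
  summand_module (D i).
pose phi i : dm_hom (inflation (V i)) P := summand_val (D i).
pose M i := inflation (V i).
pose c := dm_hom_of (copair_hom phi : is_hom (copair phi : direct_sum M -> P)).
have c_inj : injective c.
  suff c0 f : c f = 0 -> f = 0.
    by move=> f g fg; apply/subr0_eq/c0; rewrite linearB fg subrr.
  move=> cf0; pose x (e : J) : P :=
    if insub e is Some i then phi i (ds_val f i) else 0.
  have xE i : x (val i) = phi i (ds_val f i) by rewrite /x valK.
  apply: ds_eqP => i; have [iS|] := boolP (i \in ds_supp f); last first.
    by rewrite mem_ds_supp negbK => /eqP.
  apply: (summand_inj (s := D i)); rewrite linear0 -xE.
  apply: (Fi [seq val i | i <- ds_supp f] x); last exact: map_f.
  - by rewrite map_inj_uniq ?fset_uniq //; exact: val_inj.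
  - by move=> _ /mapP[j _ ->]; exact: set_valP.
  - move=> _ /mapP[j _ ->]; rewrite xE; exact: summand_image.
  - by rewrite big_map -[RHS]cf0; apply: eq_bigr => j _; exact: xE.
have [r rK] : exists r : dm_hom P (direct_sum M), cancel c r.
  apply: (identity_is_trace_injective Gcompact Knorm) => //.
  by apply: direct_sum_identity_is_trace => // i; exact: summand_trace.
exists I, H, V; split=> [i|]; first exact: summand_spec.
exists r, c; split=> //.
pose d y := y - c (r y).
have c_image (e : J) y : F e -> (e : P -> P) y = y -> d y = 0.
  move=> Fe ey; pose i : I := exist _ e (mem_set Fe).
  have [v <-] := summand_surj (D i) ey.
  have <- : c (ds_inj (M := M) v) = phi i v := copair_inj phi v.
  by rewrite /d rK subrr.
have hd : is_hom d.
  split=> [a u v|g m].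
    by rewrite /d (linearP r) (linearP c) scalerBr opprD addrACA.
  by rewrite /d !dm_funJ dm_actB.
have dd y : d (d y) = d y.
  by rewrite {1}/d {2}/d linearB rK subrr linear0 subr0.
move=> y; apply/esym/subr0_eq; apply: contrapT => /eqP dy.
have [e [n [ie re prim e0 de]]] :=
  primitive_idempotent_exists Gcompact Knorm trP (conj hd dd) (dd y) dy.
have ce : component e by split=> //; exists n.
have nFe : ~ F (e : J).
  move=> Fe; have [z /eqP[]] := e0; rewrite -de.
  by apply: (c_image e) => //; exact: ie.2.
apply: nFe; apply: Fmax => // s x us sF xs sum0.
have dx e' : e' \in s -> d (x e') = if e' == e then x e' else 0.
  move=> e's; case: eqP => [ee'|ne'].
    by rewrite -[in LHS](xs _ e's) {1}ee' de -ee' xs.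
  by case: (sF _ e's) => // Fe'; exact: (c_image e' _ Fe' (xs _ e's)).
have dsum : \sum_(e' <- s) d (x e') = 0.
  have := congr1 d sum0; rewrite -[d]/(linear_of hd.1 : P -> P).
  by rewrite linear_sum linear0.
have xe : (e : J) \in s -> x e = 0.
  move=> es; move: dsum.
  rewrite (big_rem _ es) /= dx // eqxx big_seq big1 ?addr0 //.
  move=> e'; rewrite mem_rem_uniq // inE => /andP[/negPf ne' e's].
  by rewrite dx // ne'.
move=> e1 e1s; have [e1e|ne1] := eqVneq e1 e; first by rewrite e1e xe // -e1e.
apply: (Fi [seq e' <- s | e' != e] x (filter_uniq _ us)).
- move=> e'; rewrite mem_filter => /andP[/eqP ne' e's].
  by case: (sF _ e's).
- by move=> e'; rewrite mem_filter => /andP[_ /xs].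
- rewrite big_filter; move: sum0; rewrite (bigID (fun e' => e' != e)) /=.
  rewrite [X in _ + X]big1_seq ?addr0 // => e' /andP[/negPn/eqP -> es].
  exact: xe.
- by rewrite mem_filter ne1.
Qed.

End Decomposition.

Theorem corollary3p3 (k : fieldType) (p : nat) (G : topologicalGroupType)
    (charkp : has_characteristic k p) (Gprofinite : profinite G) :
  (forall H : openNormal G, order_prime_to p (subgroup H) ->
     forall V : lmodType (group_algebra k (quotient_group H)),
       projective_module V <-> projective_object (inflation V)) /\
  (forall M : discreteModule k G,
     projective_object M <->
     exists (I : choiceType) (H : I -> openNormal G)
            (V : forall i, lmodType (group_algebra k (quotient_group (H i)))),
       (forall i, [/\ order_prime_to p (subgroup (H i)),
                      finite_dimensional (underlying (V i)),
                      indecomposable_module (V i) &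
                      projective_module (V i)]) /\
       dm_isomorphic M (direct_sum (fun i => inflation (V i)))).
Proof.
have Gcompact : compact [set: G] by case: Gprofinite.
have norm (H : openNormal G) : order_prime_to p (subgroup H) -> normalizable k H.
  by move=> Hp W WH; exact: (order_prime_to_subindex charkp Gcompact Hp WH).
split=> [H Hp V|M].
  split; last exact: projective_inflation.
  exact: (projective_module_inflation Gcompact (norm _ Hp)).
split=> [projM|[I [H [V [VP [f [g [fK gK]]]]]]]]; last first.
  have projV i : projective_object (inflation (V i)).
    have [Hp _ _ projVi] := VP i.
    exact: (projective_module_inflation Gcompact (norm _ Hp)).
  move=> A B e u epi_e.
  have hu := is_hom_comp (dm_homP u) (dm_homP g).
  have [h eh] := direct_sum_projective projV (dm_hom_of hu) epi_e.
  exists (dm_hom_of (is_hom_comp (dm_homP h) (dm_homP f))) => x /=.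
  by rewrite eh /= fK.
have [M0|] := pselect (forall x : M, x = 0); last first.
  move=> /existsNP[x /eqP x0].
  have [K Kp] := projective_prime_to charkp Gcompact projM x0.
  apply: (decomposition charkp Gcompact (norm _ Kp)).
  exact: (projective_identity_is_trace Gcompact (norm _ Kp)).
pose H (i : void) : openNormal G := match i with end.
pose V (i : void) : lmodType (group_algebra k (quotient_group (H i))) :=
  match i with end.
exists void, H, V; split=> [[]|].
exists (dm_hom_of (is_hom0 _ _)), (dm_hom_of (is_hom0 _ _)).
by split=> [x|f]; [rewrite [RHS]M0|apply: ds_eqP => -[]].
Qed.
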